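(* Let $N\ge 2$, $2\le p<N$, $r_0>e$, $C_H=\left|\frac{p-N}{p}\right|^p$, $C_*=\frac{p-1}{2p}\left|\frac{p-N}{p}\right|^{p-2}$, $\varepsilon\in\,]0,C_*]$, and consider the equation $$-\Delta_p u-\frac{C_H}{|x|^p}|u|^{p-2}u-\frac{\varepsilon}{|x|^p\log^{2}|x|}|u|^{p-2}u=0\quad\text{in }B]r_0,\infty[.$$ Let $\beta_\varepsilon\le\bar\beta_\varepsilon$ be the real roots of $\frac12\left|\frac{p-N}{p}\right|^{p-2}(p-1)(2-\beta p)\beta=\varepsilon$. Then: (a) for every positive (not necessarily radial) $C^2$-supersolution $w$ of the equation and every $\tau<0$ there is $C>0$ with $$|x|^{\frac{p-N}{p}}(\log|x|)^{\beta_\varepsilon}(\log\log|x|)^\tau\le C\,w(x)\quad\text{for all }x\in B[r_0,\infty[;$$ (b) for every positive radial strictly monotone decreasing $C^2$-supersolution $v$ of the equation, $$\limsup_{|x|\to\infty}\frac{|x|^{\frac{p-N}{p}}(\log|x|)^{\bar\beta_\varepsilon}(\log\log|x|)^\tau}{v(x)}>0$$ whenever either $\varepsilon<C_*$ and $\tau>0$, or $\varepsilon=C_*$ and $\tau>2/p$.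
   Context: $\Delta_p u=\nabla\cdot(|\nabla u|^{p-2}\nabla u)$. $B]r_0,\infty[=\{x\in\mathbb{R}^N:|x|>r_0\}$, $B[r_0,\infty[=\{x:|x|\ge r_0\}$. A $C^2$-supersolution is a function $w\in C^2(B[r_0,\infty[)$ for which the left-hand side of the equation evaluated at $w$ is $\ge 0$ pointwise in $B]r_0,\infty[$. A radial function $v(x)=\phi(|x|)$ is strictly monotone decreasing if $\phi'(r)<0$ for all $r\ge r_0$. (For $0<\varepsilon<C_*$ one has $0<\beta_\varepsilon<\frac1p<\bar\beta_\varepsilon<\frac2p$, and for $\varepsilon=C_*$, $\beta_\varepsilon=\bar\beta_\varepsilon=\frac1p$.) *)

(* Defs.v *)
From HB Require Import structures.
From mathcomp Require Import all_boot all_order all_algebra.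
From mathcomp Require Import all_classical all_reals all_analysis.
Set Implicit Arguments. Unset Strict Implicit. Unset Printing Implicit Defensive.
Import Order.TTheory GRing.Theory Num.Theory.
Import numFieldNormedType.Exports.
Local Open Scope classical_set_scope.
Local Open Scope ring_scope.

Section PLap.
Variables (R : realType) (N : nat).

(* Euclidean norm |x| on R^N (the library norm on matrices is the max norm). *)
Definition eucl (x : 'rV[R]_N) : R := Num.sqrt (\sum_(i < N) x ord0 i ^+ 2).

Definition ev (i : 'I_N) : 'rV[R]_N := delta_mx ord0 i.

Definition pd (i : 'I_N) (f : 'rV[R]_N -> R) : 'rV[R]_N -> R :=
  fun x => derive f x (ev i).

Definition gradnorm (f : 'rV[R]_N -> R) (x : 'rV[R]_N) : R :=
  Num.sqrt (\sum_(i < N) pd i f x ^+ 2).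

Definition plap (p : R) (u : 'rV[R]_N -> R) (x : 'rV[R]_N) : R :=
  \sum_(i < N) pd i (fun y => (gradnorm u y) `^ (p - 2) * pd i u y) x.

Definition ext_open (r0 : R) : set 'rV[R]_N := [set x | r0 < eucl x].
Definition ext_closed (r0 : R) : set 'rV[R]_N := [set x | r0 <= eucl x].

Definition C2_ext (r0 : R) (w : 'rV[R]_N -> R) : Prop :=
  [/\ (forall x, ext_open r0 x -> forall i j : 'I_N,
         derivable w x (ev i) /\ derivable (pd i w) x (ev j)),
      {within ext_closed r0, continuous w},
      (forall i : 'I_N, exists g : 'rV[R]_N -> R,
         {within ext_closed r0, continuous g} /\
         forall x, ext_open r0 x -> g x = pd i w x) &
      (forall i j : 'I_N, exists g : 'rV[R]_N -> R,
         {within ext_closed r0, continuous g} /\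
         forall x, ext_open r0 x -> g x = pd j (pd i w) x)].

Definition eq_lhs (p CH eps : R) (u : 'rV[R]_N -> R) (x : 'rV[R]_N) : R :=
  - plap p u x
  - CH / (eucl x `^ p) * (`|u x| `^ (p - 2) * u x)
  - eps / (eucl x `^ p * (ln (eucl x)) ^+ 2) * (`|u x| `^ (p - 2) * u x).

Definition supersol (p CH eps r0 : R) (w : 'rV[R]_N -> R) : Prop :=
  C2_ext r0 w /\ forall x, ext_open r0 x -> 0 <= eq_lhs p CH eps w x.

End PLap.

(* Main.v *)
Require Import Defs.
From HB Require Import structures.
From mathcomp Require Import all_boot all_order all_algebra.
From mathcomp Require Import all_classical all_reals all_analysis.
From mathcomp Require Import ring lra.
Import Order.TTheory GRing.Theory Num.Theory.
Import numFieldNormedType.Exports.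
Local Open Scope classical_set_scope.
Local Open Scope ring_scope.

(** Put t = ln |x|, gam = (N - p) / p, L = ln t and epsn = eps / ((p - 1) gam^(p-2)).
    Suppose exp (z t - gam t) touches a positive supersolution w from below at
    a point where q = z' < gam.  Comparing second derivatives of w along the
    axes and along the radius turns the differential inequality for w into an
    algebraic one for q and z'', and Bernoulli type bounds for (1 - q/gam)^(2-p)
    give
      (i)  z'' + q^2 < 0,
      (ii) z'' + (p/2) q^2 + epsn / t^2 <= 0  whenever q >= 0.
    By (i) the functions exp (- gam t) (T - t) cannot touch w; with T -> oo this
    shows that exp (gam t) times the minimum of w over |x| = exp t is
    nondecreasing in t, so every touching function has q >= 0 and (ii) always
    applies.  Writing z = (2/p) ln chi, (ii) becomes the linear inequality
    chi'' + a (1 - a) chi / t^2 <= 0, where a = p beta / 2 <= 1/2 and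
    1 - a = p betab / 2.

    (a) chi = t^a L^(-s) - delta t^(1-a), s > 0, is a strict subsolution of the
    linear equation which is eventually negative, hence it stays below a multiple
    of (w exp (gam t))^(p/2); let delta -> 0.

    (b) A radial decreasing supersolution touches itself everywhere, so
    chi = (v exp (gam t))^(p/2) satisfies chi'' + a (1 - a) chi / t^2 <= 0 on a
    half-line.  Then t^(2a) (chi t^(-a))' is nonincreasing, and integration gives
    chi = O(t^(1-a)) if a < 1/2 and chi = O(t^(1-a) L) if a = 1/2. *)

Set Implicit Arguments.
Unset Strict Implicit.

(** * One-variable calculus *)

Lemma is_derive_MVT {R : realType} (f df : R -> R) (a b : R) : a < b ->
  (forall s, a <= s <= b -> is_derive s 1 f (df s)) ->
  exists2 c, a < c < b & f b - f a = df c * (b - a).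
Proof.
move=> ab fd.
have [||c cab E] := @MVT R f df a b ab.
- by move=> s; rewrite in_itv => /andP[a1 a2]; apply: fd; rewrite !ltW.
- by apply: derivable_within_continuous => s; rewrite in_itv => /fd.
by exists c => //; move: cab; rewrite in_itv.
Qed.

Lemma is_derive_ler {R : realType} (f df : R -> R) (a b : R) : a <= b ->
  (forall s, a <= s <= b -> is_derive s 1 f (df s)) ->
  (forall s, a < s < b -> 0 <= df s) -> f a <= f b.
Proof.
rewrite le_eqVlt => /predU1P[->//|ab] fd f0.
have [c cab E] := is_derive_MVT ab fd.
by rewrite -subr_ge0 E mulr_ge0 ?subr_ge0 ?f0 // ltW.
Qed.

Lemma is_derive_ger {R : realType} (f df : R -> R) (a b : R) : a <= b ->
  (forall s, a <= s <= b -> is_derive s 1 f (df s)) ->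
  (forall s, a < s < b -> df s <= 0) -> f b <= f a.
Proof.
rewrite le_eqVlt => /predU1P[->//|ab] fd f0.
have [c cab E] := is_derive_MVT ab fd.
by rewrite -subr_le0 E mulr_le0_ge0 ?subr_ge0 ?f0 // ltW.
Qed.

Lemma is_derive_comp1 {R : realType} (f g : R -> R) (x a b : R) :
  is_derive (g x) 1 f a -> is_derive x 1 g b ->
  is_derive x 1 (fun s => f (g s)) (a * b).
Proof. exact: is_derive1_comp. Qed.

Lemma is_derive_mul1 {R : realType} (f g : R -> R) (x a b : R) :
  is_derive x 1 f a -> is_derive x 1 g b ->
  is_derive x 1 (fun s => f s * g s) (a * g x + f x * b).
Proof.
move=> fa gb; apply: (@is_derive_eq _ _ _ _ _ _ _ _ (is_deriveM fa gb)).
by rewrite /GRing.scale /= addrC [g x * a]mulrC.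
Qed.

Lemma is_derive_comp_inv {R : realType} (g : R -> R) (x b : R) : g x != 0 ->
  is_derive x 1 g b -> is_derive x 1 (fun s => (g s)^-1) (- b / (g x) ^+ 2).
Proof.
move=> g0 gb; apply: (@is_derive_eq _ _ _ _ _ _ _ _ (is_deriveV g0 gb)).
by rewrite /GRing.scale /= mulrC mulrN mulNr.
Qed.

Lemma is_derive_comp_ln {R : realType} (g : R -> R) (x b : R) : 0 < g x ->
  is_derive x 1 g b -> is_derive x 1 (fun s => ln (g s)) (b / g x).
Proof.
move=> g0 gb; rewrite mulrC.
by apply: is_derive_comp1 gb; apply: is_derive1_ln.
Qed.

Lemma is_derive_comp_expR {R : realType} (g : R -> R) (x b : R) :
  is_derive x 1 g b -> is_derive x 1 (fun s => expR (g s)) (b * expR (g x)).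
Proof.
move=> gb; rewrite mulrC.
exact: (is_derive_comp1 (is_derive_expR (g x)) gb).
Qed.

Lemma is_derive_comp_powR {R : realType} (a : R) (g : R -> R) (x b : R) :
  0 < g x -> is_derive x 1 g b ->
  is_derive x 1 (fun s => g s `^ a) (a * g x `^ (a - 1) * b).
Proof.
by move=> g0 gb; exact: (is_derive_comp1 (is_derive1_powR a g0) gb).
Qed.

Lemma is_derive_affine {R : realType} (a b x : R) :
  is_derive x 1 (fun s : R => a * s + b) a.
Proof.
have -> : (fun s : R => a * s + b) = (a \*: id + cst b).
  by apply/funext => s.
by apply: is_derive_eq; rewrite /GRing.scale /= mulr1 addr0.
Qed.

Lemma is_derive_mull1 {R : realType} (c x : R) : is_derive x 1 (fun s : R => c * s) c.
Proof.
have -> : (fun s : R => c * s) = (fun s => c * s + 0) by apply/funext => s; rewrite addr0.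
exact: is_derive_affine.
Qed.

(** Writing (1 - u)^(-k) as exp (- k ln (1 - u)), this follows from 1 + y <= exp y and ln (1 - u) <=
    - u. *)
Lemma powRN_bernoulli {R : realType} (k u : R) : 0 <= k -> u < 1 ->
  1 + k * u <= (1 - u) `^ (- k).
Proof.
move=> k0 u1; have v0 : 0 < 1 - u by rewrite subr_gt0.
rewrite /powR gt_eqF //; apply: le_trans (expR_ge1Dx _).
rewrite lerD2l mulNr -mulrN ler_wpM2l // lerNr.
by apply: le_ln1Dx; rewrite ltrN2.
Qed.

Lemma expR_ge_sqr {R : realType} (s : R) : 0 <= s -> 1 + s + s ^+ 2 / 2 <= expR s.
Proof.
move=> s0; rewrite -subr_ge0.
pose f t : R := expR t + (- (t + t ^+ 2 / 2)).
pose df t : R := expR t - (1 + t).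
have fd (t : R) : is_derive t 1 f (df t).
  rewrite /f /df.
  have D1 : is_derive t 1 (fun s : R => s + s ^+ 2 / 2) (1 + t).
    have -> : (fun s : R => s + s ^+ 2 / 2) = (id + 2^-1 \*: (id ^+ 2)).
      by apply/funext => r /=; rewrite /GRing.scale /= mulrC.
    by apply: is_derive_eq; rewrite /GRing.scale /= !mulr1 expr1 mulrA mulVf ?mul1r.
  exact: is_deriveB.
have := @is_derive_ler R f df 0 s s0 (fun t _ => fd t).
rewrite /f /df expR0 add0r expr2 !mul0r oppr0 addr0.
rewrite -[_ <= _ + _]subr_ge0 => H.
apply: le_trans (H _) _; last by rewrite le_eqVlt; apply/orP; left; apply/eqP; ring.
by move=> t _; rewrite subr_ge0 expR_ge1Dx.
Qed.

(** The same exponential form with the second-order bounds - ln (1 - u) >= u + u^2/2 and exp y >= 1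
    + y + y^2/2. The quadratic terms k u^2/2 and k^2 u^2/2 add up to the last term on the left. *)
Lemma powRN_bernoulli2 {R : realType} (k u : R) : 0 <= k -> 0 <= u < 1 ->
  1 + k * u + k * (k + 1) / 2 * u ^+ 2 <= (1 - u) `^ (- k).
Proof.
move=> k0 /andP[u0 u1]; have v0 : 0 < 1 - u by rewrite subr_gt0.
have lnu : u + u ^+ 2 / 2 <= - ln (1 - u).
  pose f t : R := - ln (1 - t) - (t + t ^+ 2 / 2).
  pose df t : R := (1 - t)^-1 - (1 + t).
  have fd (t : R) : 0 <= t <= u -> is_derive t 1 f (df t).
    move=> /andP[t0 tu]; rewrite /f /df.
    have t1 : 0 < 1 - t by rewrite subr_gt0 (le_lt_trans tu).
    have D1 : is_derive t 1 (fun s : R => s + s ^+ 2 / 2) (1 + t).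
      have -> : (fun s : R => s + s ^+ 2 / 2) = (id + 2^-1 \*: (id ^+ 2)).
        by apply/funext => r /=; rewrite /GRing.scale /= mulrC.
      by apply: is_derive_eq; rewrite /GRing.scale /= !mulr1 expr1 mulrA mulVf ?mul1r.
    have D2 : is_derive t 1 (fun s : R => - ln (1 - s)) ((1 - t)^-1).
      have Da := is_derive_affine (-1) 1 t.
      have -> : (fun s : R => - ln (1 - s)) = \- (fun s : R => ln (-1 * s + 1)).
        by apply/funext => s /=; rewrite mulN1r addrC.
      have := @is_derive_comp_ln R (fun s => -1 * s + 1) t (-1).
      rewrite mulN1r [- t + 1]addrC => /(_ t1 Da) H.
      by apply: is_derive_eq; rewrite mulN1r opprK.
    exact: is_deriveB.
  have := @is_derive_ler R f df 0 u u0 fd.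
  rewrite /f /df subr0 ln1 expr2 mul0r add0r mul0r oppr0 addr0 subr_ge0; apply.
  move=> t /andP[t0 tu]; have t1 : 0 < 1 - t by rewrite subr_gt0 (lt_trans tu).
  by rewrite subr_ge0 -[_^-1]mul1r ler_pdivlMr //; nra.
rewrite /powR gt_eqF // mulNr -mulrN.
set l := - ln _ in lnu *.
have l0 : 0 <= l by apply: le_trans lnu; nra.
apply: le_trans (expR_ge_sqr (mulr_ge0 k0 l0)).
have h1 : k * (u + u ^+ 2 / 2) <= k * l by rewrite ler_wpM2l.
have h2 : k * u <= k * l by apply: le_trans h1; rewrite ler_wpM2l //; nra.
have h3 : (k * u) ^+ 2 <= (k * l) ^+ 2 by rewrite lerXn2r // nnegrE mulr_ge0.
lra.
Qed.

(** * Directional derivatives and radial touching functions *)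

Section Directional.
Context {R : realType} {V : normedModType R}.

Lemma is_derive_cvgP (f : V -> R) (x v : V) (a : R) :
  is_derive x v f a <->
  h^-1 * (f (x + h *: v) - f x) @[h --> 0^'] --> a.
Proof.
have E : (fun h : R => h^-1 *: ((f \o shift x) (h *: v) - f x)) =
         (fun h : R => h^-1 * (f (x + h *: v) - f x)).
  by apply/funext => h /=; rewrite [h *: v + x]addrC.
split.
  by move=> [D <-]; rewrite -E; exact: D.
rewrite -E => H; apply: DeriveDef; first by apply/cvg_ex; exists a.
exact: cvg_lim.
Qed.

(** The two difference quotients coincide, so derivatives along a line can be computed by
    one-variable calculus and carried back. *)
Lemma is_derive_line (f : V -> R) (x v : V) (s a : R) :
  is_derive (x + s *: v) v f a <->
  is_derive s 1 (fun r : R => f (x + r *: v)) a.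
Proof.
rewrite is_derive_cvgP.
have E : (fun h : R => h^-1 * (f (x + s *: v + h *: v) - f (x + s *: v))) =
  (fun h : R => h^-1 *: (((fun r : R => f (x + r *: v)) \o shift s) (h *: 1) -
     f (x + s *: v))).
  apply/funext => h /=; rewrite /GRing.scale /= mulr1.
  by rewrite -addrA -scalerDl [s + h]addrC.
split.
  rewrite E => H; apply: DeriveDef; first by apply/cvg_ex; exists a.
  exact: cvg_lim.
by move=> [D <-]; rewrite E; exact: D.
Qed.
End Directional.

(** * Directional derivatives from continuous partial derivatives *)

Section ContinuousPartials.
Context {R : realType} {N : nat}.
Implicit Types (f : 'rV[R]_N -> R) (x u v : 'rV[R]_N).

(** The mean value theorem on the segment of direction e_k starting at the moving point x + h u
    gives an intermediate point that tends to x, where the partial derivative is continuous. *)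
Lemma partial_increment_cvg f x u (c : R) (k : 'I_N) :
  (\forall y \near x, derivable f y (ev R k)) ->
  {for x, continuous (pd k f)} ->
  h^-1 * (f (x + h *: u + h *: (c *: ev R k)) - f (x + h *: u)) @[h --> 0^'] -->
  c * pd k f x.
Proof.
move=> fd fc; apply/cvgrPdist_lt => e e0.
have d0 : 0 < e / (`|c| + 1) by rewrite divr_gt0 // ltr_pwDr.
have := fc _ (nbhsx_ballx (pd k f x) _ d0).
move=> /nbhs_ballP[d1 /= d1p B1].
have /nbhs_ballP[d2 /= d2p B2] := fd.
pose d := Num.min d1 d2; have dp : 0 < d by rewrite lt_min d1p.
(* Every point of the segment lies within |h| K of x. *)
pose K := `|u| + `|c *: ev R k| + 1.
have Kp : 0 < K by rewrite ltr_pwDr.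
have nearK : \forall h \near (0 : R)^', `|h| * K < d.
  have := @dnbhs0_lt R R (d / K); rewrite divr_gt0 // => /(_ isT).
  by apply: filterS => h; rewrite ltr_pdivlMr.
near=> h.
have hK : `|h| * K < d by near: h.
have h0 : h != 0 by near: h; exact: nbhs_dnbhs_neq.
pose P (s : R) := x + h *: u + (s * (h * c)) *: ev R k.
have Px s : 0 <= s <= 1 -> `|x - P s| < d.
  move=> /andP[s0 s1]; apply: le_lt_trans hK.
  have -> : x - P s = - (h *: (u + s *: (c *: ev R k))).
    rewrite /P -addrA opprD addrA subrr sub0r; congr (- _).
    rewrite scalerDr; congr (_ + _).
    by rewrite !scalerA; congr (_ *: _); ring.
  rewrite normrN normrZ ler_wpM2l // (le_trans (ler_normD _ _)) //.
  rewrite /K -addrA lerD2l normrZ ger0_norm //.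
  have : s * `|c *: ev R k| <= 1 * `|c *: ev R k| by rewrite ler_wpM2r.
  by rewrite mul1r => Hs; rewrite (le_trans Hs) // lerDl.
have gd (s : R) : 0 <= s <= 1 ->
    is_derive s 1 (fun s => f (P s)) (pd k f (P s) * (h * c)).
  move=> s01; have fP : derivable f (P s) (ev R k).
    apply: B2; rewrite -ball_normE /=.
    by apply: lt_le_trans (Px _ s01) _; rewrite ge_min lexx orbT.
  have D1 : is_derive (s * (h * c)) 1
     (fun r : R => f (x + h *: u + r *: ev R k)) (pd k f (P s)).
    apply: (proj1 (is_derive_line f (x + h *: u) (ev R k) (s * (h * c)) _)).
    exact: (DeriveDef fP erefl).
  have D2 : is_derive s 1 (fun s : R => s * (h * c)) (h * c).
    have -> : (fun s : R => s * (h * c)) = (fun s => (h * c) * s + 0).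
      by apply/funext => r; rewrite addr0 mulrC.
    exact: is_derive_affine.
  pose F r := f (x + h *: u + r *: ev R k).
  have Q := @is_derive_comp1 R F (fun s => s * (h * c)) s _ _ D1 D2.
  exact: Q.
have [s /andP[s0 s1]] := is_derive_MVT ltr01 gd.
rewrite /P mul1r mul0r scale0r addr0 subr0 mulr1 => E.
rewrite [h *: (c *: _)]scalerA E -/(P s).
have -> : h^-1 * (pd k f (P s) * (h * c)) = c * pd k f (P s) by field.
rewrite -mulrBr normrM.
have s01 : 0 <= s <= 1 by rewrite !ltW.
have : `|pd k f x - pd k f (P s)| < e / (`|c| + 1).
  have : ball x d1 (P s).
    rewrite -ball_normE /=.
    by apply: lt_le_trans (Px _ s01) _; rewrite ge_min lexx.
  by move=> /B1 /=; rewrite -ball_normE.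
rewrite ltr_pdivlMr ?ltr_pwDr // => Hlt.
apply: le_lt_trans Hlt.
by rewrite mulrDr mulr1 mulrC lerDl.
Unshelve. all: by end_near. Qed.

Lemma is_derive_continuous_partials f x v :
  (\forall y \near x, forall i, derivable f y (ev R i)) ->
  (forall i, {for x, continuous (pd i f)}) ->
  is_derive x v f (\sum_i v ord0 i * pd i f x).
Proof.
move=> fd fc.
have -> : v = \sum_(i <- index_enum 'I_N) v ord0 i *: ev R i.
  exact: row_sum_delta.
rewrite [X in is_derive _ _ _ X](_ : _ =
   \sum_(i <- index_enum 'I_N) v ord0 i * pd i f x); last first.
  by rewrite -row_sum_delta.
elim: (index_enum _) => [|k s IH].
  by rewrite !big_nil; exact: is_derive0.
rewrite !big_cons; move: IH.
set u := \sum_(i <- s) _; set b := \sum_(i <- s) _.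
move=> /is_derive_cvgP IH; apply/is_derive_cvgP.
have fdk : \forall y \near x, derivable f y (ev R k) by apply: filterS fd => y; apply.
have H := cvgD (@partial_increment_cvg f x u (v ord0 k) k fdk (fc k)) IH.
apply: (cvg_trans _ (H _)).
apply: near_eq_cvg; near=> h.
rewrite -[LHS]/(h^-1 * (f (x + h *: u + h *: (v ord0 k *: ev R k)) -
  f (x + h *: u)) + h^-1 * (f (x + h *: u) - f x)).
rewrite -mulrDr addrA subrK scalerDr.
by rewrite [h *: (_ *: _) + _]addrC [in RHS]addrA.
Unshelve. all: by end_near. Qed.
End ContinuousPartials.

(** The first derivative vanishes by Fermat's rule. Were [g2] negative, [g1] would be negative just
    to the right of 0, and the mean value theorem would put [g] below its minimum there. *)
Lemma second_order_min {R : realType} (g g1 : R -> R) (g2 : R) :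
  (\forall s \near (0 : R), is_derive (s : R) 1 g (g1 s)) -> is_derive (0 : R) 1 g1 g2 ->
  (\forall s \near (0 : R), g 0 <= g s) -> g1 0 = 0 /\ 0 <= g2.
Proof.
move=> gd g1d gmin.
have /nbhs_ballP[d /= d0 B] : \forall s \near (0 : R),
    is_derive (s : R) 1 g (g1 s) /\ g 0 <= g s by apply: filterI.
have Bd s : `|s| < d -> is_derive (s : R) 1 g (g1 s) /\ g 0 <= g s.
  by move=> sd; apply: B; rewrite /ball /= sub0r normrN.
have g10 : g1 0 = 0.
  have D0 : is_derive (0 : R) 1 g 0.
    apply: (@derive1_at_min R g (- d) d 0); rewrite ?in_itv /=; try lra.
    - move=> s; rewrite in_itv /= => sd.
      by have [[]] : is_derive (s : R) 1 g (g1 s) /\ g 0 <= g s by apply: Bd; rewrite ltr_norml.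
    - move=> s; rewrite in_itv /= => sd.
      by have [] : is_derive (s : R) 1 g (g1 s) /\ g 0 <= g s by apply: Bd; rewrite ltr_norml.
  have [D1 _] : is_derive (0 : R) 1 g (g1 0) /\ g 0 <= g 0 by apply: Bd; rewrite normr0.
  by rewrite -(derive_val (is_derive := D1)) (derive_val (is_derive := D0)).
split=> //; rewrite leNgt; apply/negP => g2n.
have := proj1 (is_derive_cvgP g1 0 1 g2) g1d.
move=> /cvgrPdist_lt /(_ (- g2)); rewrite oppr_gt0 => /(_ g2n).
move=> /nbhs_ballP[d' /= d'0 B'].
pose m := Num.min d d' / 2.
have m0 : 0 < m by rewrite divr_gt0 // lt_min d0.
have mm : m < d /\ m < d'.
  have : m < Num.min d d' by rewrite /m ltr_pdivrMr // ltr_pMr ?lt_min ?d0 //; lra.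
  by rewrite lt_min => /andP.
have fd s : 0 <= s <= m -> is_derive (s : R) 1 g (g1 s).
  by move=> /andP[s0 sm]; apply: (proj1 (Bd s _)); rewrite ger0_norm //; lra.
have [c /andP[c0 cm] E] := is_derive_MVT m0 fd.
have g1c : g1 c < 0.
  have /= : ball (0 : R) d' c by rewrite /ball /= sub0r normrN gtr0_norm //; lra.
  move=> /B' /= /(_ (lt0r_neq0 c0)).
  rewrite add0r g10 subr0 /GRing.scale /= mulr1 ltr_norml => /andP[H _].
  have : c^-1 * g1 c < 0 by lra.
  by rewrite [c^-1 * _]mulrC pmulr_llt0 ?invr_gt0.
have : g 0 <= g m by apply: (proj2 (Bd m _)); rewrite gtr0_norm //; lra.
by rewrite -subr_ge0 E subr0 nmulr_rge0 // leNgt m0.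
Qed.

(** * The Euclidean norm and C^2 functions outside a ball *)

Section Euclid.
Context {R : realType} {N : nat}.
Implicit Types (x y v : 'rV[R]_N).

Definition edot x y : R := \sum_i x ord0 i * y ord0 i.

Lemma eucl_sqr x : eucl x ^+ 2 = edot x x.
Proof.
rewrite /eucl sqr_sqrtr; last by apply: sumr_ge0 => i _; rewrite sqr_ge0.
by apply: eq_bigr => i _; rewrite expr2.
Qed.

Lemma edot_line x v (s : R) :
  edot (x + s *: v) (x + s *: v) = edot x x + 2 * s * edot x v + s ^+ 2 * edot v v.
Proof.
rewrite /edot !mulr_sumr -!big_split /=; apply: eq_bigr => i _.
by rewrite !mxE; ring.
Qed.

Lemma edot_ev x i : edot x (ev R i) = x ord0 i.
Proof.
rewrite /edot (bigD1 i) //= big1 => [|j ji]; rewrite !mxE ?eqxx ?mulr1 ?addr0 //=.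
by rewrite (negbTE ji) mulr0.
Qed.

(** Removes the square root: along a line, ln |x| becomes half the logarithm of a quadratic
    polynomial. *)
Lemma ln_eucl x : 0 < eucl x -> ln (eucl x) = 2^-1 * ln (edot x x).
Proof.
by move=> x0; rewrite -eucl_sqr lnXn // -[ln _ *+ 2]mulr_natl mulrA mulVf ?mul1r.
Qed.

Lemma continuous_eucl : continuous (@eucl R N).
Proof.
move=> x; apply: (@continuous_comp _ _ _ (fun x => \sum_i x ord0 i ^+ 2)).
  have -> : (fun x : 'rV[R]_N => \sum_i x ord0 i ^+ 2) =
     \sum_i (fun x : 'rV[R]_N => x ord0 i ^+ 2).
    by apply/funext => y; rewrite fct_sumE.
  apply: (big_ind (fun f : 'rV[R]_N -> R => {for x, continuous f})).
  - exact: (@cst_continuous _ _ (0 : R) x).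
  - by move=> f g; exact: continuousD.
  move=> i _; rewrite /prop_for /continuous_at.
  have C := @coord_continuous R 1 N ord0 i x.
  exact: (cvgM C C).
exact: sqrt_continuous.
Qed.

Lemma open_ext_open (r0 : R) : open (@ext_open R N r0).
Proof.
apply: (@open_comp _ _ (@eucl R N) [set r | r0 < r]).
  by move=> x _; exact: continuous_eucl.
exact: open_gt.
Qed.

Lemma near_ext_open (r0 : R) x : ext_open r0 x -> \forall y \near x, ext_open r0 y.
Proof. by move=> xr; apply: open_nbhs_nbhs; split => //; exact: open_ext_open. Qed.

Section C2.
Variables (r0 : R) (w : 'rV[R]_N -> R).
Hypothesis wC2 : C2_ext r0 w.

(** The extension [g] is continuous within the closed exterior. On the open exterior this is
    ordinary continuity, and [g] agrees with [f] near x. *)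
Lemma ext_continuous (f g : 'rV[R]_N -> R) x : ext_open r0 x ->
  {within ext_closed r0, continuous g} -> (forall x, ext_open r0 x -> g x = f x) ->
  {for x, continuous f}.
Proof.
move=> xr gc gf.
have gc' : {for x, continuous g}.
  have go : {within ext_open r0, continuous g}.
    by apply: continuous_subspaceW gc => y; rewrite /ext_open /ext_closed /= => /ltW.
  by rewrite continuous_open_subspace in go; [apply: go; rewrite inE | exact: open_ext_open].
rewrite /prop_for /continuous_at -(gf _ xr).
have E : {near nbhs x, g =1 f}.
  by apply: filterS (near_ext_open xr) => y yr; rewrite gf.
exact: (cvg_trans (near_eq_cvg E) gc').
Qed.

Lemma C2_ext_is_derive x v : ext_open r0 x ->
  is_derive x v w (\sum_i v ord0 i * pd i w x).
Proof.
move=> xr; case: wC2 => wd _ wg _; apply: is_derive_continuous_partials.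
  apply: filterS (near_ext_open xr) => y yr i.
  by have [] := wd y yr i i.
by move=> i; have [g [gc gE]] := wg i; apply: (ext_continuous xr gc gE).
Qed.

Lemma C2_ext_is_derive2 x v i : ext_open r0 x ->
  is_derive x v (pd i w) (\sum_j v ord0 j * pd j (pd i w) x).
Proof.
move=> xr; case: wC2 => wd _ _ wg; apply: is_derive_continuous_partials.
  apply: filterS (near_ext_open xr) => y yr j.
  by have [] := wd y yr i j.
by move=> j; have [g [gc gE]] := wg i j; apply: (ext_continuous xr gc gE).
Qed.

End C2.
End Euclid.

Lemma is_derive_scale1 {R : realType} (c : R) (f : R -> R) (x a : R) :
  is_derive x 1 f a -> is_derive x 1 (fun s => c * f s) (c * a).
Proof. by move=> fa; exact: is_deriveZ. Qed.

Lemma is_derive_sum1 {R : realType} n (h : 'I_n -> R -> R) (dh : 'I_n -> R) (x : R) :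
  (forall i, is_derive x 1 (h i) (dh i)) ->
  is_derive x 1 (fun s => \sum_i h i s) (\sum_i dh i).
Proof.
move=> hd; have -> : (fun s => \sum_i h i s) = \sum_i h i.
  by apply/funext => s; rewrite fct_sumE.
exact: is_derive_sum.
Qed.

(** * Second-order conditions at a touching point *)

Section Touching.
Context {R : realType} {N : nat}.
Variables (r0 : R) (w : 'rV[R]_N -> R) (x : 'rV[R]_N).
Hypothesis r00 : 0 < r0.
Hypothesis wC2 : C2_ext r0 w.
Hypothesis xr : ext_open r0 x.

Let hess i j : R := pd j (pd i w) x.

Lemma edot_gt0 : 0 < edot x x.
Proof. by rewrite -eucl_sqr exprn_gt0 // (lt_trans r00). Qed.

(** The function s -> w (x + s v) - Psi (ln |x + s v|) has a local minimum at 0. With q = x.x, b =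
    x.v and c = v.v, the map s -> ln |x + s v| has derivatives b/q and c/q - 2 (b/q)^2 at 0, and the
    chain rule turns the conditions for a minimum into the two claims. *)
Lemma touching_line (v : 'rV[R]_N) (Psi Psi1 : R -> R) (Psi2 : R) :
  (\forall s \near ln (eucl x), is_derive (s : R) 1 Psi (Psi1 s)) ->
  is_derive (ln (eucl x)) 1 Psi1 Psi2 ->
  Psi (ln (eucl x)) = w x ->
  (\forall y \near x, Psi (ln (eucl y)) <= w y) ->
  \sum_i v ord0 i * pd i w x = Psi1 (ln (eucl x)) * (edot x v / edot x x) /\
  Psi2 * (edot x v / edot x x) ^+ 2 + Psi1 (ln (eucl x)) *
    (edot v v / edot x x - 2 * (edot x v / edot x x) ^+ 2) <=
  \sum_i v ord0 i * \sum_j v ord0 j * hess i j.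
Proof.
move=> Pd P1d Pw Ple.
have q0 := edot_gt0; have xr' : 0 < eucl x by rewrite (lt_trans r00).
set q := edot x x in q0 *; set b := edot x v; set c := edot v v.
pose P (s : R) := q + 2 * s * b + s ^+ 2 * c.
pose L s := 2^-1 * ln (P s); pose L1 s := (b + s * c) / P s.
have line_cont : {for (0 : R), continuous (fun s : R => x + s *: v)}.
  apply: differentiable_continuous.
  exact/differentiableD/differentiableZl.
have near_line (Q : 'rV[R]_N -> Prop) : (\forall y \near x, Q y) ->
    \forall s \near (0 : R), Q (x + s *: v).
  move=> Qx; apply: line_cont.
  by rewrite /= scale0r addr0.
have LE : \forall s \near (0 : R), ln (eucl (x + s *: v)) = L s /\ 0 < P s.
  apply: filterS (near_line _ (near_ext_open xr)) => s sr.
  have s0 : 0 < eucl (x + s *: v) by rewrite (lt_trans r00).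
  by rewrite ln_eucl // edot_line; split=> //; rewrite /P -edot_line -eucl_sqr exprn_gt0.
have Pder (s : R) : is_derive s 1 P (2 * b + 2 * s * c).
  have -> : P = (fun s => (c * s + 2 * b) * s + q).
    by apply/funext => r; rewrite /P; ring.
  have D1 := is_derive_mul1 (is_derive_affine c (2 * b) s) (is_derive_id s (1 : R)).
  have -> : (fun s => (c * s + 2 * b) * s + q) =
      (fun s => (c * s + 2 * b) * s) + cst q by [].
  by apply: is_derive_eq; rewrite /=; ring.
have Lder (s : R) : 0 < P s -> is_derive s 1 L (L1 s).
  move=> Ps; have D := is_derive_scale1 2^-1 (is_derive_comp_ln Ps (Pder s)).
  by apply: (is_derive_eq D); rewrite /L1; field; rewrite gt_eqF.
have P0 : P 0 = q by rewrite /P; ring.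
have L10 : L1 0 = b / q by rewrite /L1 P0 mul0r addr0.
have L0 : L 0 = ln (eucl x) by rewrite ln_eucl // /L P0.
have Lcont : {for (0 : R), continuous L}.
  apply: differentiable_continuous; apply/derivable1_diffP.
  by have [] : is_derive (0 : R) 1 L (L1 0) by apply: Lder; rewrite P0.
have L1der : is_derive (0 : R) 1 L1 (c / q - 2 * (b / q) ^+ 2).
  have P00 : P 0 != 0 by rewrite P0 gt_eqF.
  have D1 := is_derive_comp_inv P00 (Pder 0).
  have D2 := is_derive_mul1 (is_derive_affine c b 0) D1.
  have -> : L1 = (fun s => (c * s + b) / P s).
    by apply/funext => s; rewrite /L1 addrC [s * c]mulrC.
  by apply: (is_derive_eq D2); rewrite P0; field; rewrite gt_eqF.
have PdL : \forall s \near (0 : R), is_derive (L s) 1 Psi (Psi1 (L s)).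
  have /Lcont : nbhs (L 0) (fun r : R => is_derive r 1 Psi (Psi1 r)) by rewrite L0.
  by [].
pose g (s : R) := w (x + s *: v) - Psi (L s).
pose g1 (s : R) := \sum_i v ord0 i * pd i w (x + s *: v) - Psi1 (L s) * L1 s.
have gd : \forall s \near (0 : R), is_derive (s : R) 1 g (g1 s).
  near=> s.
  have s1 : is_derive s 1 (fun s => Psi (L s)) (Psi1 (L s) * L1 s).
    apply: (@is_derive_comp1 R Psi L); first by near: s.
    by apply: Lder; near: s; apply: filterS LE => s [].
  have s2 : is_derive s 1 (fun s => w (x + s *: v))
      (\sum_i v ord0 i * pd i w (x + s *: v)).
    apply: (proj1 (is_derive_line w x v s _)); apply: (C2_ext_is_derive wC2).
    by near: s; apply: near_line; exact: near_ext_open.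
  exact: is_deriveB.
have g1d : is_derive (0 : R) 1 g1 (\sum_i v ord0 i * \sum_j v ord0 j * hess i j -
    (Psi2 * (b / q) ^+ 2 + Psi1 (ln (eucl x)) * (c / q - 2 * (b / q) ^+ 2))).
  have D0 : is_derive (0 : R) 1 (fun s => \sum_i v ord0 i * pd i w (x + s *: v))
      (\sum_i v ord0 i * \sum_j v ord0 j * hess i j).
    apply: is_derive_sum1 => i; apply: is_derive_scale1.
    apply: (proj1 (is_derive_line (pd i w) x v 0 _)).
    by rewrite scale0r addr0; apply: (C2_ext_is_derive2 wC2).
  have D1 : is_derive (0 : R) 1 (fun s => Psi1 (L s)) (Psi2 * (b / q)).
    rewrite -L10; apply: (@is_derive_comp1 R Psi1 L); first by rewrite L0.
    by apply: Lder; rewrite P0.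
  have D2 := is_derive_mul1 D1 L1der.
  have D3 : is_derive (0 : R) 1 (fun s => Psi1 (L s) * L1 s)
     (Psi2 * (b / q) ^+ 2 + Psi1 (ln (eucl x)) * (c / q - 2 * (b / q) ^+ 2)).
    by apply: (is_derive_eq D2); rewrite L10 L0; ring.
  exact: is_deriveB.
have gmin : \forall s \near (0 : R), g 0 <= g s.
  rewrite /g scale0r addr0 L0 Pw subrr.
  apply: filterS2 LE (near_line _ Ple) => s [<- _].
  by rewrite subr_ge0.
have [E I] := second_order_min gd g1d gmin.
split; last by rewrite -subr_ge0.
move: E; rewrite /g1 scale0r addr0 L0 L10 => /eqP.
by rewrite subr_eq0 => /eqP.
Unshelve. all: by end_near. Qed.

End Touching.

(** A quadratic form takes the same value on a matrix and on its transpose; this swaps the mixed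
    partials that arise from differentiating the squared gradient. *)
Lemma exchange_form {R : realType} n (d : 'I_n -> R) (H : 'I_n -> 'I_n -> R) :
  \sum_i d i * (\sum_j d j * H j i) = \sum_i d i * (\sum_j d j * H i j).
Proof.
under eq_bigr do rewrite mulr_sumr.
rewrite exchange_big; apply: eq_bigr => i _ /=.
by rewrite mulr_sumr; apply: eq_bigr => j _; rewrite mulrCA.
Qed.

(** * The p-Laplacian at a touching point *)

Section PLaplacian.
Context {R : realType} {N : nat}.
Variables (r0 : R) (w : 'rV[R]_N -> R) (x : 'rV[R]_N).
Hypothesis r00 : 0 < r0.
Hypothesis wC2 : C2_ext r0 w.
Hypothesis xr : ext_open r0 x.

(** The nondivergence form for p = k + 2, obtained by differentiating S^(k/2) times each partial
    derivative along its axis; S > 0 makes the power differentiable. *)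
Lemma plap_expand (k : R) : let S := \sum_i pd i w x ^+ 2 in 0 < S ->
  plap (k + 2) w x = S `^ (k / 2) *
   (\sum_i pd i (pd i w) x +
    k / S * \sum_i pd i w x * \sum_j pd j w x * pd j (pd i w) x).
Proof.
move=> S S0; rewrite /plap.
have dE i : pd i (fun y => gradnorm w y `^ (k + 2 - 2) * pd i w y) x =
   S `^ (k / 2) * (pd i (pd i w) x +
     k / S * (pd i w x * \sum_j pd j w x * pd i (pd j w) x)).
  pose F j (s : R) := pd j w (x + s *: ev R i).
  have Fd j : is_derive (0 : R) 1 (F j) (pd i (pd j w) x).
    apply: (proj1 (is_derive_line (pd j w) x (ev R i) 0 _)).
    rewrite scale0r addr0; apply: (is_derive_eq (C2_ext_is_derive2 wC2 (ev R i) j xr)).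
    rewrite (bigD1 i) //= big1 => [|l li]; rewrite !mxE ?eqxx ?mul1r ?addr0 //=.
    by rewrite (negbTE li) mul0r.
  have F0 j : F j 0 = pd j w x by rewrite /F scale0r addr0.
  pose T (s : R) := \sum_j F j s * F j s.
  have T0 : T 0 = S by apply: eq_bigr => j _; rewrite F0 expr2.
  have Td : is_derive (0 : R) 1 T (2 * \sum_j pd j w x * pd i (pd j w) x).
    have D := is_derive_sum1 (fun j => is_derive_mul1 (Fd j) (Fd j)).
    apply: (is_derive_eq D); rewrite mulr_sumr; apply: eq_bigr => j _.
    by rewrite F0; ring.
  have T00 : 0 < T 0 by rewrite T0.
  have D := is_derive_mul1 (is_derive_comp_powR (k / 2) T00 Td) (Fd i).
  have E : (fun s => T s `^ (k / 2) * F i s) =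
      (fun s : R => gradnorm w (x + s *: ev R i) `^ (k + 2 - 2) * pd i w (x + s *: ev R i)).
    apply/funext => s; congr (_ * _).
    rewrite /gradnorm (eq_bigr (fun j => F j s * F j s)); last first.
      by move=> j _; rewrite expr2.
    rewrite addrK -powR12_sqrt; last by apply: sumr_ge0 => j _; rewrite -expr2 sqr_ge0.
    by rewrite -powRrM [2^-1 * k]mulrC.
  rewrite E in D.
  have D' := proj2 (is_derive_line
    (fun y => gradnorm w y `^ (k + 2 - 2) * pd i w y) x (ev R i) 0 _) D.
  rewrite scale0r addr0 in D'.
  rewrite {1}/pd (derive_val (is_derive := D')).
  rewrite T0 F0 powRB ?(lt0r_neq0 S0) ?implybT // powRr1 ?ltW //.
  by field; rewrite gt_eqF.
rewrite (eq_bigr _ (fun i _ => dE i)) -mulr_sumr big_split /= -mulr_sumr.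
have sumE := exchange_form (fun i => pd i w x) (fun i j => pd j (pd i w) x).
exact: (congr1 (fun z => S `^ (k / 2) *
  (\sum_i pd i (pd i w) x + k / S * z)) sumE).
Qed.

(** The gradient at the touching point is radial. The axis directions bound the Laplacian from
    below, the direction x bounds the Hessian form on the gradient, and the weights in [plap_expand]
    are nonnegative because k >= 0. *)
Lemma plap_touching (k : R) (Psi Psi1 : R -> R) (Psi2 : R) :
  let t := ln (eucl x) in 0 <= k ->
  (\forall s \near t, is_derive (s : R) 1 Psi (Psi1 s)) ->
  is_derive t 1 Psi1 Psi2 -> Psi1 t < 0 -> Psi t = w x ->
  (\forall y \near x, Psi (ln (eucl y)) <= w y) ->
  (- Psi1 t / eucl x) `^ k / eucl x ^+ 2 *
    ((k + 1) * Psi2 + (N%:R - 2 - k) * Psi1 t) <= plap (k + 2) w x.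
Proof.
move=> t k0 Pd P1d P1n Pw Ple.
have q0 := edot_gt0 r00 xr; have xr' : 0 < eucl x by rewrite (lt_trans r00).
have TL v := touching_line r00 wC2 xr v Pd P1d Pw Ple.
rewrite -/t in TL; rewrite eucl_sqr; set q := edot x x in q0 TL *.
set c := Psi1 t in P1n TL *.
have dE i : pd i w x = c / q * x ord0 i.
  have [+ _] := TL (ev R i); rewrite edot_ev.
  rewrite (bigD1 i) //= big1 => [|l li]; rewrite !mxE ?eqxx ?mul1r ?addr0 //=.
    by move=> ->; ring.
  by rewrite (negbTE li) mul0r.
have hE i : Psi2 * (x ord0 i / q) ^+ 2 + c * (1 / q - 2 * (x ord0 i / q) ^+ 2) <=
   pd i (pd i w) x.
  have [_] := TL (ev R i); rewrite !edot_ev [ev R i ord0 i]mxE !eqxx.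
  rewrite [X in _ <= X -> _](bigD1 i) //= [X in _ <= _ + X -> _]big1 => [|l li]; last first.
    by rewrite !mxE (negbTE li) mul0r.
  rewrite (bigD1 i) //= [X in _ <= _ * (_ + X) + _ -> _]big1 => [|l li]; last first.
    by rewrite !mxE (negbTE li) mul0r.
  by rewrite !mxE !eqxx !mul1r !addr0.
(* For v = x the ratio x.v / x.x is 1, so the lower bound becomes Psi'' - Psi'. *)
have [_ Hx] := TL x.
have SE : \sum_i pd i w x ^+ 2 = c ^+ 2 / q.
  under eq_bigr => i _ do rewrite dE exprMn expr2 [x ord0 i ^+ 2]expr2.
  by rewrite -mulr_sumr -/(edot x x) -/q; field; rewrite gt_eqF.
have S0 : 0 < \sum_i pd i w x ^+ 2.
  by rewrite SE divr_gt0 // expr2 nmulr_rgt0.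
rewrite plap_expand // SE.
have -> : (c ^+ 2 / q) `^ (k / 2) = (- c / eucl x) `^ k.
  have -> : c ^+ 2 / q = (- c / eucl x) `^ 2.
    rewrite powR_mulrn; last by rewrite divr_ge0 // ?oppr_ge0 ltW.
    by rewrite expr_div_n sqrrN eucl_sqr.
  by rewrite -powRrM; congr (_ `^ _); field.
rewrite -mulrA ler_wpM2l ?powR_ge0 //.
have -> : \sum_i pd i w x * (\sum_j pd j w x * pd j (pd i w) x) =
   (c / q) ^+ 2 * \sum_i x ord0 i * (\sum_j x ord0 j * pd j (pd i w) x).
  rewrite mulr_sumr; apply: eq_bigr => i _.
  have -> : \sum_j pd j w x * pd j (pd i w) x =
      c / q * \sum_j x ord0 j * pd j (pd i w) x.
    by rewrite mulr_sumr; apply: eq_bigr => j _; rewrite dE mulrA.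
  by rewrite dE; ring.
have H1 : Psi2 / q + c * (N%:R - 2) / q <= \sum_i pd i (pd i w) x.
  apply: le_trans (ler_sum _ (fun i _ => hE i)).
  rewrite (eq_bigr (fun i => (Psi2 - 2 * c) / q ^+ 2 * (x ord0 i * x ord0 i) + c / q));
    last by move=> i _; field; rewrite gt_eqF.
  rewrite big_split /= -mulr_sumr -/(edot x x) -/q sumr_const card_ord.
  rewrite -[_ *+ N]mulr_natr le_eqVlt; apply/orP; left; apply/eqP.
  by field; rewrite gt_eqF.
have qV : q / q = 1 by rewrite divff // gt_eqF.
rewrite -/q qV expr1n !mulr1 in Hx.
set X := \sum_i x ord0 i * _ in Hx *.
have -> : k / (c ^+ 2 / q) * ((c / q) ^+ 2 * X) = k / q * X.
  by field; rewrite gt_eqF // lt_eqF.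
have H2 : k / q * (Psi2 - c) <= k / q * X.
  by rewrite ler_wpM2l ?divr_ge0 ?(ltW q0) //; lra.
apply: le_trans (lerD H1 H2); rewrite le_eqVlt; apply/orP; left; apply/eqP.
by field; rewrite gt_eqF.
Qed.
End PLaplacian.

Lemma is_derive_continuous {R : realType} (f : R -> R) (x d : R) :
  is_derive x 1 f d -> {for x, continuous f}.
Proof. by case=> fx _; apply: differentiable_continuous; apply/derivable1_diffP. Qed.

Lemma is_derive_lt0_left {R : realType} (f : R -> R) (a x d : R) :
  is_derive x 1 f d -> d < 0 -> a < x -> exists2 y, a < y < x & f x < f y.
Proof.
move=> fd d0 ax.
have := proj1 (is_derive_cvgP f x 1 d) fd.
move=> /cvgrPdist_lt /(_ (- d)); rewrite oppr_gt0 => /(_ d0).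
move=> /nbhs_ballP[e /= e0 B].
pose m := Num.min e (x - a) / 2.
have m0 : 0 < m by rewrite divr_gt0 // lt_min e0 subr_gt0.
have [me ma] : m < e /\ m < x - a.
  have : m < Num.min e (x - a).
    by rewrite /m ltr_pdivrMr // ltr_pMr ?ltr1n // lt_min e0 subr_gt0.
  by rewrite lt_min => /andP.
have /= : ball (0 : R) e (- m) by rewrite /ball /= sub0r opprK gtr0_norm.
move=> /B /=; rewrite oppr_eq0 gt_eqF // => /(_ isT).
rewrite /GRing.scale /= mulr1 ltr_norml => /andP[H _].
have {}H : (- m)^-1 * (f (x - m) - f x) < 0 by lra.
exists (x - m); first by lra.
by move: H; rewrite nmulr_rlt0 ?subr_gt0 // invr_lt0 oppr_lt0.
Qed.

(** * Sweeping over annuli *)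

Section Annulus.
Context {R : realType} {N : nat}.

Lemma coord_le_eucl (x : 'rV[R]_N) i : `|x ord0 i| <= eucl x.
Proof.
rewrite -sqrtr_sqr ler_wsqrtr // (bigD1 i) //= lerDl.
by apply: sumr_ge0 => j _; rewrite sqr_ge0.
Qed.

Lemma eucl_ge0 (x : 'rV[R]_N) : 0 <= eucl x.
Proof. exact: sqrtr_ge0. Qed.

Lemma eucl_axis (r : R) (i : 'I_N) : 0 <= r -> eucl (r *: ev R i) = r.
Proof.
move=> r_ge0; rewrite /eucl (bigD1 i) //= big1 => [|j ji].
  by rewrite !mxE !eqxx mulr1 addr0 sqrtr_sqr ger0_norm.
by rewrite !mxE (negbTE ji) andbF mulr0 expr0n.
Qed.

Lemma compact_annulus (a b : R) : compact [set x : 'rV[R]_N | a <= eucl x <= b].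
Proof.
apply: bounded_closed_compact.
  exists b; split; first exact: num_real.
  move=> c bc x /= /andP[_ xb].
  rewrite [`|x|]mx_normrE; apply/bigmax_leP; split => [|[i j] _].
    by rewrite (le_trans (eucl_ge0 x)) // (le_trans xb) // ltW.
  by rewrite ord1 (le_trans (coord_le_eucl x j)) // (le_trans xb) // ltW.
have -> : [set x : 'rV[R]_N | a <= eucl x <= b] =
    (@eucl R N) @^-1` [set r | a <= r] `&` (@eucl R N) @^-1` [set r | r <= b].
  by apply/seteqP; split => x /= => [/andP[]|[-> ->]].
apply: closedI; apply: closed_comp.
- by move=> x _; exact: continuous_eucl.
- exact: closed_ge.
- by move=> x _; exact: continuous_eucl.
- exact: closed_le.
Qed.

Lemma continuous_ln_eucl (x : 'rV[R]_N) : 0 < eucl x ->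
  {for x, continuous (fun y : 'rV[R]_N => ln (eucl y))}.
Proof.
move=> x0; apply: (@continuous_comp _ _ _ (@eucl R N) (@ln R)).
  exact: continuous_eucl.
exact: continuous_ln.
Qed.

(* The largest ratio [chi (ln |x|) / W x] over an annulus either respects the
   bound prescribed on the inner sphere or is attained inside, where
   [chi (ln |x|)] touches a multiple of [W] from below. *)
Lemma annulus_sweep (r0 t1 T B : R) (chi : R -> R) (W : 'rV[R]_N -> R) :
  0 < r0 -> r0 < expR t1 -> 0 < B ->
  (forall x, ext_closed r0 x -> 0 < W x) ->
  {within ext_closed r0, continuous W} ->
  (forall t, t1 <= t <= T -> {for t, continuous chi}) ->
  chi T <= 0 ->
  (forall y : 'rV[R]_N, eucl y = expR t1 -> B * chi t1 <= W y) ->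
  (forall x : 'rV[R]_N, expR t1 <= eucl x <= expR T ->
     B * chi (ln (eucl x)) <= W x) \/
  exists x M, [/\ expR t1 < eucl x < expR T, 0 < M,
     chi (ln (eucl x)) = M * W x &
     forall y : 'rV[R]_N, expR t1 <= eucl y <= expR T -> chi (ln (eucl y)) <= M * W y].
Proof.
move=> r00 r0t B0 W0 Wc chic chiT chit1.
pose A := [set x : 'rV[R]_N | expR t1 <= eucl x <= expR T].
have AW x : A x -> ext_closed r0 x.
  by move=> /andP[x1 _]; rewrite /ext_closed /= (le_trans _ x1) // ltW.
case: (pselect (forall x : 'rV[R]_N, A x -> B * chi (ln (eucl x)) <= W x)).
  by move=> H; left; exact: H.
move=> /existsNP[x0 /not_implyP[Ax0 /negP]]; rewrite -ltNge => Bx0.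
right; pose f (x : 'rV[R]_N) := chi (ln (eucl x)) * (W x)^-1.
have fc : {within A, continuous f}.
  apply/subspace_continuousP => x Ax.
  have x0' : 0 < eucl x by case/andP: Ax => + _; exact: lt_le_trans (expR_gt0 _).
  apply: cvgM.
    have C : {for x, continuous (fun y : 'rV[R]_N => chi (ln (eucl y)))}.
      apply: (@continuous_comp _ _ _ (fun y : 'rV[R]_N => ln (eucl y)) chi).
        exact: continuous_ln_eucl.
      apply: chic; case/andP: Ax => x1 x2.
      by rewrite -ler_expR -[X in _ && X]ler_expR lnK // x1.
    by apply: (cvg_trans _ C); apply: cvg_app; exact: cvg_within.
  apply: cvgV; first by rewrite gt_eqF // W0 //; exact: AW.
  have WA : {within A, continuous W} by apply: continuous_subspaceW Wc; exact: AW.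
  by move/subspace_continuousP: WA; apply.
have [c] := EVT_max_rV (ex_intro _ x0 Ax0) (@compact_annulus _ _) fc.
rewrite inE => Ac cmax.
have Wc0 : 0 < W c by apply: W0; exact: AW.
have c0 : 0 < eucl c by case/andP: Ac => + _; exact: lt_le_trans (expR_gt0 _).
(* The bound fails at [x0], so the maximal ratio exceeds 1/B. *)
have fB : B^-1 < f c.
  apply: (@lt_le_trans _ _ (f x0)); last by apply: cmax; rewrite inE.
  rewrite /f ltr_pdivlMr; last by apply: W0; exact: AW.
  by rewrite mulrC ltr_pdivrMr // mulrC.
have M0 : 0 < f c by rewrite (lt_trans _ fB) // invr_gt0.
have chiE : chi (ln (eucl c)) = f c * W c by rewrite /f divfK // gt_eqF.
exists c, (f c); split => //; last first.
  move=> y Ay; rewrite -ler_pdivrMr; last by apply: W0; exact: AW.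
  by apply: cmax; rewrite inE.
(* The maximum is not on the inner sphere, where the ratio is at most 1/B, nor on the outer one,
   where [chi] is nonpositive. *)
case/andP: Ac => c1 c2; rewrite !lt_neqAle c1 c2 !andbT; apply/andP; split.
  apply/eqP => cE; have := chit1 c (esym cE).
  rewrite -[t1]expRK cE chiE leNgt mulrA => /negP; apply.
  by rewrite ltr_pMl // mulrC -ltr_pdivrMr // mul1r.
apply/eqP => cE; move: chiT; rewrite -[T]expRK -cE chiE leNgt => /negP; apply.
exact: mulr_gt0.
Qed.
End Annulus.

(** * The Riccati inequality *)

Section RiccatiGrowth.
Context {R : realType}.
Variables (p a th t0 : R) (z z1 z2 : R -> R).
Hypotheses (p0 : 0 < p).
Hypothesis zd : forall t, t0 < t -> is_derive (t : R) 1 z (z1 t).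
Hypothesis z1d : forall t, t0 < t -> is_derive (t : R) 1 z1 (z2 t).
Hypothesis zcc : forall t, t0 < t -> z2 t + z1 t ^+ 2 < 0.

(* [exp z] is positive and concave on a half-line. *)
Lemma concave_expR_nondecreasing t : t0 < t -> 0 <= z1 t.
Proof.
move=> t0t; rewrite leNgt; apply/negP => z1t.
(* The slope of exp z at [t] is - d, and concavity keeps all later slopes at most - d. *)
pose d := - (z1 t * expR (z t)).
have d0 : 0 < d by rewrite oppr_gt0 nmulr_rlt0 ?expR_gt0.
have psid s : t0 < s -> is_derive (s : R) 1 (fun s => expR (z s)) (z1 s * expR (z s)).
  by move=> ts; exact: is_derive_comp_expR (zd ts).
pose psi2 (u : R) := z2 u * expR (z u) + z1 u * (z1 u * expR (z u)).
have slope s : t <= s -> z1 s * expR (z s) <= - d.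
  move=> ts; rewrite opprK.
  apply: (@is_derive_ger R (fun s => z1 s * expR (z s)) psi2 t s ts) => u /andP[tu _].
    have t0u : t0 < u by exact: lt_le_trans tu.
    exact: is_derive_mul1 (z1d t0u) (psid u t0u).
  have -> : psi2 u = (z2 u + z1 u ^+ 2) * expR (z u) by rewrite /psi2; ring.
  by rewrite mulr_le0_ge0 ?expR_ge0 // ltW // zcc // (lt_trans t0t).
(* Here the tangent line of exp z at [t] reaches zero, which would force exp z to be nonpositive. *)
pose s := t + expR (z t) / d.
have ts : t <= s by rewrite lerDl divr_ge0 ?expR_ge0 // ltW.
have : expR (z s) + d * s <= expR (z t) + d * t.
  apply: (@is_derive_ger R (fun s => expR (z s) + d * s)
     (fun u => z1 u * expR (z u) + d) t s ts) => u /andP[tu _].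
    have t0u : t0 < u by exact: lt_le_trans tu.
    exact: (is_deriveD (psid u t0u) (is_derive_mull1 d u)).
  by have := slope u (ltW tu); lra.
have -> : d * s = d * t + expR (z t) by rewrite /s mulrDr mulrCA divff ?mulr1 // gt_eqF.
by have := expR_gt0 (z s); lra.
Qed.

Hypothesis a12 : a <= 1 / 2.
Hypothesis zric : forall t, t0 < t -> 0 <= z1 t ->
  z2 t + p / 2 * z1 t ^+ 2 + 2 / p * (a * (1 - a)) / t ^+ 2 <= 0.
Hypothesis ath : (a < 1 / 2 /\ 0 < th) \/ (a = 1 / 2 /\ 1 < th).

(* [t^(2a) (chi t^(-a))'] is nonincreasing for [chi = exp (p z / 2)], because
   [t^a] solves the linear equation of which [chi] is a supersolution. *)
Lemma riccati_growth : exists C t2, forall t, t2 <= t ->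
  p / 2 * z t <= C + ((1 - a) * ln t + th * ln (ln t)).
Proof.
(* Beyond e one has ln t >= 1, so ln (ln t) is nonnegative. *)
pose t2 := Num.max t0 (expR 1) + 1.
have [t2t0 t2e] : t0 < t2 /\ expR 1 < t2.
  by rewrite /t2; split; rewrite ltr_pwDr // le_max lexx ?orbT.
have t00 t : t2 <= t -> t0 < t by exact: lt_le_trans.
have tpos t : t2 <= t -> 0 < t.
  by apply: lt_le_trans; rewrite (lt_trans (expR_gt0 1)).
have L1 t : t2 <= t -> 1 <= ln t.
  move=> tt; rewrite -[leLHS](expRK (1 : R)) ler_ln ?posrE ?expR_gt0 ?tpos //.
  by rewrite ltW // (lt_le_trans t2e).
have L0 t : t2 <= t -> 0 < ln t by move/L1; exact: lt_le_trans.
(* exp zeta is chi t^(-a), and the product of [W] and [zeta1] below is t^(2a) (chi t^(-a))'. *)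
pose zeta t := p / 2 * z t - a * ln t.
pose zeta1 (t : R) := p / 2 * z1 t - a * t^-1.
pose zeta2 (t : R) := p / 2 * z2 t - a * (- 1 / t ^+ 2).
have zetad (t : R) : t2 <= t -> is_derive t 1 zeta (zeta1 t).
  move=> tt; exact: (is_deriveB (is_derive_scale1 (p / 2) (zd (t00 t tt)))
    (is_derive_scale1 a (is_derive1_ln (tpos t tt)))).
have Vd (t : R) : t2 <= t -> is_derive t 1 (fun s : R => s^-1) (- 1 / t ^+ 2).
  move=> tt; have s0 : t != 0 by rewrite gt_eqF // tpos.
  exact: (is_derive_comp_inv (g := id) s0 (is_derive_id t (1 : R))).
have zeta1d (t : R) : t2 <= t -> is_derive t 1 zeta1 (zeta2 t).
  move=> tt; exact: (is_deriveB (is_derive_scale1 (p / 2) (z1d (t00 t tt)))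
    (is_derive_scale1 a (Vd t tt))).
pose W t := expR (2 * a * ln t + zeta t).
have Wd (t : R) : t2 <= t -> is_derive t 1 W ((2 * a * t^-1 + zeta1 t) * W t).
  move=> tt; apply: is_derive_comp_expR.
  exact: (is_deriveD (is_derive_scale1 (2 * a) (is_derive1_ln (tpos t tt))) (zetad t tt)).
have Jmono t : t2 <= t -> W t * zeta1 t <= W t2 * zeta1 t2.
  move=> tt; apply: (@is_derive_ger R (fun t => W t * zeta1 t)
    (fun t => (2 * a * t^-1 + zeta1 t) * W t * zeta1 t + W t * zeta2 t) t2 t tt) => s /andP[ts _].
    exact: is_derive_mul1 (Wd s ts) (zeta1d s ts).
  have {}ts := ltW ts.
  have -> : (2 * a * s^-1 + zeta1 s) * W s * zeta1 s + W s * zeta2 s =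
    W s * (p / 2 * (z2 s + p / 2 * z1 s ^+ 2 + 2 / p * (a * (1 - a)) / s ^+ 2)).
    by rewrite /zeta1 /zeta2; field; rewrite (gt_eqF p0) (gt_eqF (tpos s ts)).
  rewrite pmulr_rle0 ?expR_gt0 // pmulr_rle0 ?divr_gt0 //.
  by apply: zric (t00 s ts) _; apply: concave_expR_nondecreasing; exact: t00.
pose K := `|W t2 * zeta1 t2| + 1.
have K0 : 0 < K by rewrite ltr_pwDr.
(* [V] is t^(1-2a) L^th with L = ln t, the barrier for exp zeta. *)
pose V t := expR ((1 - 2 * a) * ln t + th * ln (ln t)).
pose V1 (t : R) := ((1 - 2 * a) * t^-1 + th * (t^-1 / ln t)) * V t.
have Vvd (t : R) : t2 <= t -> is_derive t 1 V (V1 t).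
  move=> tt; have D1 := is_derive1_ln (tpos t tt).
  have D2 := is_derive_comp_ln (L0 t tt) D1.
  exact: (is_derive_comp_expR
    (is_deriveD (is_derive_scale1 (1 - 2 * a) D1) (is_derive_scale1 th D2))).
have th0 : 0 < th by case: ath => -[_]; [|exact: lt_trans].
have a20 : 0 <= 1 - 2 * a by move: a12; lra.
have LL0 t : t2 <= t -> 0 <= ln (ln t) by move=> tt; rewrite ln_ge0 // L1.
(* V' is t^(-2a) ((1 - 2a) L^th + th L^(th-1)). The first term gives c = 1 - 2a when a < 1/2; the
   second gives c = th when a = 1/2, as th > 1. *)
have [c c0 V1c] : exists2 c, 0 < c & forall t, t2 <= t -> c * expR (- (2 * a * ln t)) <= V1 t.
  have V1E t : t2 <= t -> V1 t =
      ((1 - 2 * a) * expR (th * ln (ln t)) + th * expR ((th - 1) * ln (ln t))) *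
      expR (- (2 * a * ln t)).
    move=> tt.
    have -> : expR ((th - 1) * ln (ln t)) = expR (th * ln (ln t)) / ln t.
      by rewrite mulrBl mul1r expRB lnK ?posrE ?L0.
    rewrite /V1 [V t](_ : _ = t * expR (th * ln (ln t)) * expR (- (2 * a * ln t))); last first.
      by rewrite -[X in X * _ * _]lnK ?posrE ?tpos // -!expRD; congr expR; ring.
    by field; rewrite (gt_eqF (L0 t tt)) (gt_eqF (tpos t tt)).
  have ex1 y t : 0 < y -> t2 <= t -> 1 <= expR (y * ln (ln t)).
    by move=> y0 tt; rewrite -expR0 ler_expR mulr_ge0 ?(ltW y0) ?LL0.
  case: ath => -[ha hth].
    exists (1 - 2 * a); first by lra.
    move=> t tt; rewrite V1E // ler_pM2r ?expR_gt0 //.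
    rewrite ler_wpDr ?mulr_ge0 ?expR_ge0 ?(ltW th0) //.
    by rewrite ler_peMr // ex1.
  exists th => // t tt; rewrite V1E // ler_pM2r ?expR_gt0 //.
  rewrite ler_wpDl ?mulr_ge0 ?expR_ge0 //.
  by rewrite ler_peMr ?(ltW th0) // ex1 // subr_gt0.
exists (ln (K / c + expR (zeta t2))), t2 => t tt.
have Q0 : 0 < K / c + expR (zeta t2) by rewrite addr_gt0 ?divr_gt0 ?expR_gt0.
(* This difference is nonincreasing, since (exp zeta)' <= K t^(-2a) <= (K/c) V'. *)
have : expR (zeta t) - K / c * V t <= expR (zeta t2) - K / c * V t2.
  apply: (@is_derive_ger R (fun t => expR (zeta t) - K / c * V t)
    (fun t => zeta1 t * expR (zeta t) - K / c * V1 t) t2 t tt) => s /andP[ts _].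
    exact: (is_deriveB (is_derive_comp_expR (zetad s ts)) (is_derive_scale1 (K / c) (Vvd s ts))).
  have {}ts := ltW ts.
  rewrite subr_le0; apply: (@le_trans _ _ (K / c * (c * expR (- (2 * a * ln s))))); last first.
    by rewrite ler_pM2l ?divr_gt0 // V1c.
  rewrite mulrA divfK ?gt_eqF //.
  have -> : zeta1 s * expR (zeta s) = W s * zeta1 s * expR (- (2 * a * ln s)).
    by rewrite /W (expRD (2 * a * ln s)) expRN; field; rewrite gt_eqF // expR_gt0.
  rewrite ler_pM2r ?expR_gt0 // (le_trans (Jmono s ts)) // (le_trans (ler_norm _)) //.
  by rewrite lerDl.
have Vt2 : 0 <= K / c * V t2 by rewrite mulr_ge0 ?expR_ge0 // ltW // divr_gt0.
have V1t : 1 <= V t.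
  rewrite -expR0 ler_expR addr_ge0 ?mulr_ge0 ?LL0 ?(ltW th0) ?(ltW (L0 _ tt)) //.
have E1 : expR (zeta t2) <= expR (zeta t2) * V t by rewrite ler_peMr ?expR_ge0.
move=> H; have {}H : expR (zeta t) <= (K / c + expR (zeta t2)) * V t.
  rewrite mulrDl; lra.
have : zeta t <= ln (K / c + expR (zeta t2)) + ((1 - 2 * a) * ln t + th * ln (ln t)).
  by rewrite -ler_expR expRD lnK ?posrE.
rewrite /zeta; lra.
Qed.
End RiccatiGrowth.

(** * Positive supersolutions *)

Lemma powR_inv {R : realType} (a k : R) : 0 < a -> a^-1 `^ k = (a `^ k)^-1.
Proof. by move=> a0; rewrite -(powR_inv1 (ltW a0)) -powRrM mulN1r powRN. Qed.

Section Supersolution.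
Context {R : realType} {N : nat}.
Variables (p r0 eps : R) (w : 'rV[R]_N -> R).
Let gam : R := (N%:R - p) / p.
(* With this normalization [beta] and [betab] are the roots of
   [b - p / 2 * b ^+ 2 = epsn]. *)
Let epsn : R := eps / ((p - 1) * gam `^ (p - 2)).
Hypotheses (p2 : 2 <= p) (pN : p < N%:R) (r0e : expR 1 < r0) (eps0 : 0 < eps).
Hypothesis w0 : forall x, ext_closed r0 x -> 0 < w x.
Hypothesis wsup : supersol p (`|(p - N%:R) / p| `^ p) eps r0 w.

Let p0 : 0 < p. Proof. by rewrite (lt_le_trans _ p2). Qed.

Lemma gam_gt0 : 0 < gam.
Proof. by rewrite divr_gt0 // subr_gt0. Qed.

Let gam_pos : 0 < gam := gam_gt0.

Lemma gamE : `|(p - N%:R) / p| = gam.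
Proof. by rewrite -opprB mulNr normrN gtr0_norm // gam_gt0. Qed.

Lemma epsn_gt0 : 0 < epsn.
Proof.
by rewrite divr_gt0 // mulr_gt0 ?powR_gt0 ?gam_gt0 // subr_gt0 (lt_le_trans _ p2) // ltr1n.
Qed.

Lemma ext_ln_gt1 (x : 'rV[R]_N) : ext_open r0 x -> 1 < ln (eucl x).
Proof.
move=> xr; rewrite -[ltLHS](expRK (1 : R)) ltr_ln ?posrE ?expR_gt0 //.
  exact: lt_trans xr.
by rewrite (lt_trans (expR_gt0 1)) // (lt_trans r0e).
Qed.

(** With h = gam - q > 0, the touching function Psi = exp (z - gam t) satisfies Psi' = - h w and
    Psi'' = (z'' + h^2) w at the point. [plap_touching] bounds the p-Laplacian from below and the
    supersolution inequality bounds it from above, which leaves an algebraic inequality. *)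
Lemma log_touching (x : 'rV[R]_N) (z z1 : R -> R) (z2 : R) : let t := ln (eucl x) in
  ext_open r0 x ->
  (\forall s \near t, is_derive (s : R) 1 z (z1 s)) -> is_derive t 1 z1 z2 ->
  z1 t < gam -> expR (z t - gam * t) = w x ->
  (\forall y \near x, expR (z (ln (eucl y)) - gam * ln (eucl y)) <= w y) ->
  z2 + z1 t ^+ 2 < 0 /\
  (0 <= z1 t -> z2 + p / 2 * z1 t ^+ 2 + epsn / t ^+ 2 <= 0).
Proof.
move=> t xr zd z1d qg wE wle.
have r00 : 0 < r0 by rewrite (lt_trans (expR_gt0 1)).
have r1 : 0 < eucl x by rewrite (lt_trans r00).
have g0 := gam_gt0; have e0 := epsn_gt0.
have t1 : 1 < t := ext_ln_gt1 xr.
have [wC2 wlhs] := wsup.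
pose Psi s := expR (z s - gam * s).
pose Psi1 s := (z1 s - gam) * Psi s.
set q := z1 t in qg *; pose h := gam - q.
have h0 : 0 < h by rewrite subr_gt0.
have Psid : \forall s \near t, is_derive (s : R) 1 Psi (Psi1 s).
  apply: filterS zd => s zs; apply: is_derive_comp_expR; apply: is_deriveB.
  exact: is_derive_mull1.
have Psi1d : is_derive t 1 Psi1 ((z2 + h ^+ 2) * w x).
  have D1 : is_derive t 1 (fun s => z1 s - gam) z2.
    have D := is_deriveB z1d (is_derive_cst gam t (1 : R)).
    by apply: (is_derive_eq D); rewrite subr0.
  have D := is_derive_mul1 D1 (nbhs_singleton Psid).
  by apply: (is_derive_eq D); rewrite /Psi1 -/q /Psi wE /h; ring.
have PsiE : Psi1 t = - (h * w x) by rewrite /Psi1 /Psi wE -/q /h; ring.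
have wx0 : 0 < w x by apply: w0; exact: ltW.
have k0 : 0 <= p - 2 by rewrite subr_ge0.
have Psi1n : Psi1 t < 0 by rewrite PsiE oppr_lt0 mulr_gt0.
have := plap_touching r00 wC2 xr k0 Psid Psi1d Psi1n wE wle.
rewrite -/t PsiE opprK subrK => PL.
have := wlhs x xr; rewrite /eq_lhs gamE (gtr0_norm wx0) -/t.
have powp a : 0 < a -> a `^ p = a `^ (p - 2) * a ^+ 2.
  move=> a0; rewrite -powR_mulrn ?ltW // -powRD ?subrK //.
  by rewrite gt_eqF.
rewrite !powp // => L.
have {PL L} L : (h * w x / eucl x) `^ (p - 2) / eucl x ^+ 2 *
   ((p - 2 + 1) * ((z2 + h ^+ 2) * w x) + (N%:R - 2 - (p - 2)) * - (h * w x)) +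
   gam `^ (p - 2) * gam ^+ 2 / (eucl x `^ (p - 2) * eucl x ^+ 2) * (w x `^ (p - 2) * w x) +
   eps / (eucl x `^ (p - 2) * eucl x ^+ 2 * t ^+ 2) * (w x `^ (p - 2) * w x) <= 0.
  move: PL L; set A := _ * (_ + _); set B := plap _ _ _; set C := _ * _; set D := _ * _.
  lra.
have hk : (h * w x / eucl x) `^ (p - 2) =
    h `^ (p - 2) * w x `^ (p - 2) / eucl x `^ (p - 2).
  rewrite -powR_inv // !powRM //; try exact: ltW.
    by rewrite mulr_ge0 ?(ltW h0) ?(ltW wx0).
  by rewrite invr_ge0 ltW.
rewrite hk in L.
have NE : N%:R - 2 - (p - 2) = p * gam.
  by rewrite /gam mulrCA divff ?gt_eqF // mulr1; ring.
have kE : (h / gam) `^ (- (p - 2)) = gam `^ (p - 2) / h `^ (p - 2).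
  by rewrite powRN powRM ?invr_ge0 ?ltW // powR_inv // invfM invrK mulrC.
set P := _ `^ _ in kE.
have P0 : 0 < P by apply: powR_gt0; apply: divr_gt0.
have hk0 : 0 < h `^ (p - 2) by rewrite powR_gt0.
have gk0 : 0 < gam `^ (p - 2) by rewrite powR_gt0.
have wk0 : 0 < w x `^ (p - 2) by rewrite powR_gt0.
have rk0 : 0 < eucl x `^ (p - 2) by rewrite powR_gt0.
(* All terms share the positive factor in [M0]; dividing by it leaves P = (1 - q/gam)^(2-p) in front
   of the potential terms. *)
have core : (p - 1) * (z2 + h ^+ 2) - p * gam * h +
    P * (gam ^+ 2 + (p - 1) * (epsn / t ^+ 2)) <= 0.
  have M0 : 0 < h `^ (p - 2) * w x `^ (p - 2) * w x / (eucl x `^ (p - 2) * eucl x ^+ 2).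
    by rewrite divr_gt0 ?mulr_gt0 ?exprn_gt0.
  rewrite -(pmulr_rle0 _ M0).
  apply: le_trans L; rewrite le_eqVlt; apply/orP; left; apply/eqP.
  rewrite NE kE /epsn; field.
  rewrite !gt_eqF //; last by lra.
  by lra.
pose u := q / gam.
have hu : h / gam = 1 - u by rewrite /h /u mulrBl divff // gt_eqF.
have qu : q = gam * u by rewrite /u mulrC divfK // gt_eqF.
have u1 : u < 1 by rewrite /u ltr_pdivrMr // mul1r.
have p1 : 0 < p - 1 by rewrite subr_gt0 (lt_le_trans _ p2) // ltr1n.
have et : 0 < epsn / t ^+ 2 by rewrite divr_gt0 // exprn_gt0 // (lt_trans ltr01).
have g2 : 0 < gam ^+ 2 by rewrite exprn_gt0.
split.
  (* The linear bound is applied to P gam^2; the positive [epsn] term then makes the inequality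
     strict. *)
  have B := powRN_bernoulli k0 u1; rewrite -hu -/P in B.
  have PG : (1 + (p - 2) * u) * gam ^+ 2 <= P * gam ^+ 2 by rewrite ler_wpM2r // ltW.
  have Pe : 0 < P * ((p - 1) * (epsn / t ^+ 2)) by do 2 apply: mulr_gt0 => //.
  rewrite -(pmulr_rlt0 _ p1).
  have -> : (p - 1) * (z2 + q ^+ 2) = (p - 1) * (z2 + h ^+ 2) - p * gam * h +
     (1 + (p - 2) * u) * gam ^+ 2 by rewrite /h qu; ring.
  by clear L; lra.
move=> q0; have u0 : 0 <= u < 1 by rewrite u1 andbT /u divr_ge0 // ltW.
(* The quadratic term raises the coefficient of q^2 from 1 to p/2, and P >= 1 keeps the whole [epsn]
   term. *)
have B := powRN_bernoulli2 k0 u0; rewrite -hu -/P in B.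
have PG : (1 + (p - 2) * u + (p - 2) * (p - 2 + 1) / 2 * u ^+ 2) * gam ^+ 2 <=
  P * gam ^+ 2 by rewrite ler_wpM2r // ltW.
have P1 : 1 <= P.
  have k1 : 0 <= p - 2 + 1 by rewrite addr_ge0.
  have uu : 0 <= u by case/andP: u0.
  apply: le_trans B; rewrite -addrA lerDl; apply: addr_ge0; first exact: mulr_ge0.
  by apply: mulr_ge0; rewrite ?sqr_ge0 // divr_ge0 // mulr_ge0.
have Pe : (p - 1) * (epsn / t ^+ 2) <= P * ((p - 1) * (epsn / t ^+ 2)).
  by apply: ler_peMl => //; apply: mulr_ge0; exact: ltW.
rewrite -(pmulr_rle0 _ p1).
have -> : (p - 1) * (z2 + p / 2 * q ^+ 2 + epsn / t ^+ 2) =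
  (p - 1) * (z2 + h ^+ 2) - p * gam * h +
  (1 + (p - 2) * u + (p - 2) * (p - 2 + 1) / 2 * u ^+ 2) * gam ^+ 2 +
  (p - 1) * (epsn / t ^+ 2).
  by rewrite /h qu; set e := epsn / _; field.
by clear L; lra.
Qed.

(** The ratio of w to the Hardy profile |x|^(-gam): exp (z - gam t) touches w exactly where exp z
    touches [F]. *)
Let F (y : 'rV[R]_N) : R := w y * expR (gam * ln (eucl y)).

Let r00 : 0 < r0. Proof. by rewrite (lt_trans (expR_gt0 1)). Qed.

Lemma weighted_gt0 x : ext_closed r0 x -> 0 < F x.
Proof. by move=> xr; rewrite mulr_gt0 ?expR_gt0 ?w0. Qed.

Lemma weighted_continuous : {within ext_closed r0, continuous F}.
Proof.
case: wsup => -[_ wc _ _] _; apply/subspace_continuousP => x xr.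
apply: cvgM; first by move/subspace_continuousP: wc; apply.
have x0 : 0 < eucl x by rewrite (lt_le_trans r00).
have C : {for x, continuous (fun y : 'rV[R]_N => expR (gam * ln (eucl y)))}.
  apply: (@continuous_comp _ _ _ (fun y : 'rV[R]_N => ln (eucl y))
    (fun s => expR (gam * s))); first exact: continuous_ln_eucl.
  exact: (is_derive_continuous (is_derive_comp_expR (is_derive_mull1 gam _))).
by apply: (cvg_trans _ C); apply: cvg_app; exact: cvg_within.
Qed.

Lemma near_annulus (x : 'rV[R]_N) (a b : R) : a < eucl x < b ->
  \forall y \near x, a <= eucl y <= b.
Proof.
move=> /andP[ax xb].
have A : \forall y \near x, a < eucl y := @continuous_eucl R N x _ (lt_nbhsr ax).
have B : \forall y \near x, eucl y < b := @continuous_eucl R N x _ (lt_nbhsl xb).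
by apply: filterS2 A B => y ay yb; apply/andP; split; exact: ltW.
Qed.

(* [T - t] is not strictly concave, so [exp (- gam t) (T - t)] cannot touch [w]
   from below; let [T] tend to infinity. *)
Lemma weighted_min_nondecreasing (t1 B : R) : r0 < expR t1 -> 0 < B ->
  (forall y, eucl y = expR t1 -> B <= F y) ->
  forall x, expR t1 <= eucl x -> B <= F x.
Proof.
move=> rt1 B0 BF x xt1; set t := ln (eucl x).
have x0 : 0 < eucl x by rewrite (lt_le_trans (expR_gt0 t1)).
have t1t : t1 <= t by rewrite -ler_expR lnK.
have F0 : 0 < F x by apply: weighted_gt0; rewrite /ext_closed /= (le_trans _ xt1) // ltW.
(* Sweeping with the constant B / (T - t1) makes the bound on the inner sphere exactly B. *)
have key T : t < T -> B / (T - t1) * (T - t) <= F x.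
  move=> tT; have Tt1 : 0 < T - t1 by rewrite subr_gt0 (le_lt_trans t1t).
  have chid (s : R) : is_derive s 1 (fun s => -1 * s + T) (-1).
    exact: is_derive_affine.
  have := @annulus_sweep R N r0 t1 T (B / (T - t1)) (fun s => -1 * s + T) F r00 rt1
    (divr_gt0 B0 Tt1) weighted_gt0 weighted_continuous
    (fun s _ => is_derive_continuous (chid s)).
  case.
  - by rewrite mulN1r addNr.
  - by move=> y yt1; rewrite mulN1r [- t1 + T]addrC (divfK (lt0r_neq0 Tt1)); exact: BF.
  - move=> /(_ x); rewrite -/t mulN1r [- t + T]addrC; apply.
    by rewrite xt1 -[eucl x]lnK // ler_expR ltW.
  move=> [c [M [cA M0 cE cle]]]; exfalso.
  have cr : ext_open r0 c by case/andP: cA => + _; exact: lt_trans.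
  have c0 : 0 < eucl c by rewrite (lt_trans r00).
  have Tc : 0 < T - ln (eucl c).
    by rewrite subr_gt0 -ltr_expR lnK //; case/andP: cA.
  have nearT : \forall s \near ln (eucl c), 0 < -1 * s + T.
    apply: filterS (lt_nbhsl (_ : ln (eucl c) < T)) => [s|]; last by rewrite -subr_gt0.
    by rewrite mulN1r addrC subr_gt0.
  pose z s := ln (-1 * s + T) - ln M; pose z1 (s : R) := -1 / (-1 * s + T).
  have zd : \forall s \near ln (eucl c), is_derive (s : R) 1 z (z1 s).
    apply: filterS nearT => s Ts.
    have D0 := @is_derive_comp_ln R (fun s => -1 * s + T) s _ Ts (chid s).
    have D := is_deriveB D0 (is_derive_cst (ln M) s (1 : R)).
    by apply: (is_derive_eq D); rewrite subr0.
  have Tc' : -1 * ln (eucl c) + T != 0 by rewrite mulN1r addrC gt_eqF.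
  have z1d := is_derive_scale1 (-1) (@is_derive_comp_inv R (fun s => -1 * s + T) _ _ Tc'
    (chid (ln (eucl c)))).
  have z1n : z1 (ln (eucl c)) < gam.
    apply: lt_trans gam_gt0; rewrite /z1 mulN1r oppr_lt0 invr_gt0.
    by rewrite mulN1r addrC.
  have expz y : ext_open r0 y -> 0 < -1 * ln (eucl y) + T ->
     expR (z (ln (eucl y)) - gam * ln (eucl y)) =
     (-1 * ln (eucl y) + T) / M * expR (- (gam * ln (eucl y))).
    by move=> yr yT; rewrite expRD expRB !lnK.
  have := @log_touching c z z1 _ cr zd z1d z1n.
  case.
  - rewrite expz //; last by rewrite mulN1r addrC.
    by rewrite cE [M * F c]mulrC mulfK ?(lt0r_neq0 M0) // /F -mulrA -expRD addrN expR0 mulr1.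
  - have nearA := near_annulus cA.
    have nearTy : \forall y \near c, 0 < -1 * ln (eucl y) + T.
      exact: (continuous_ln_eucl c0 nearT).
    apply: filterS3 nearA nearTy (near_ext_open cr) => y yA yT yr.
    rewrite expz // expRN ler_pdivrMr ?expR_gt0 // ler_pdivrMr // -/(F y) [F y * M]mulrC.
    exact: cle.
  (* For the logarithm of an affine function z'' + z'^2 = 0, against the strict inequality. *)
  move=> + _; rewrite /z1 => H.
  move: H; rewrite ltNge => /negP; apply; rewrite le_eqVlt; apply/orP; left; apply/eqP.
  by field.
rewrite leNgt; apply/negP => FB.
(* At T = t + X the bound [key] forces X (B - F x) <= F x (t - t1); this [X] makes the left side
   larger by 1. *)
pose X := (F x * (t - t1) + 1) / (B - F x).
have BF0 : 0 < B - F x by rewrite subr_gt0.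
have N0 : 0 < F x * (t - t1) + 1 by rewrite ltr_wpDl // mulr_ge0 ?subr_ge0 // ltW.
have X0 : 0 < X by rewrite divr_gt0.
have XE : X * (B - F x) = F x * (t - t1) + 1 by rewrite /X divfK // gt_eqF.
have tX : t < t + X by rewrite ltrDl.
have := key _ tX; rewrite mulrAC ler_pdivrMr; last by lra.
have -> : t + X - t = X by ring.
by nra.
Qed.

(** If chi / M touches F^(p/2) from below, then z = (2/p) (ln chi - ln M) turns the Riccati
    inequality of [log_touching] into the reverse of the strict linear inequality assumed for [chi].
    What remains is z' >= 0 at the touching point. *)
Lemma subsolution_comparison (chi chi1 chi2 : R -> R) (t1 T B : R) :
  r0 < expR t1 -> 0 < B ->
  (forall t, t1 <= t <= T -> is_derive (t : R) 1 chi (chi1 t)) ->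
  (forall t, t1 < t < T -> is_derive (t : R) 1 chi1 (chi2 t)) ->
  (forall t, t1 < t < T -> 0 < chi t -> 2 / p * (chi1 t / chi t) < gam) ->
  (forall t, t1 < t < T -> 0 < chi t ->
     0 < chi2 t + p / 2 * epsn / t ^+ 2 * chi t) ->
  chi T <= 0 ->
  (forall y, eucl y = expR t1 -> B * chi t1 <= F y `^ (p / 2)) ->
  forall x, expR t1 <= eucl x <= expR T -> B * chi (ln (eucl x)) <= F x `^ (p / 2).
Proof.
move=> rt1 B0 chid chi1d chiq chiL chiT chit1.
have G0 x : ext_closed r0 x -> 0 < F x `^ (p / 2).
  by move=> xr; rewrite powR_gt0 // weighted_gt0.
have Gc : {within ext_closed r0, continuous (fun x => F x `^ (p / 2))}.
  apply/subspace_continuousP => x xr.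
  have C := @is_derive_continuous R _ _ _ (is_derive1_powR (p / 2) (weighted_gt0 xr)).
  have D : F y @[y --> within (ext_closed r0) (nbhs x)] --> F x.
    by move/subspace_continuousP: weighted_continuous; apply.
  exact: (@continuous_cvg _ _ _ _ _ _ (fun a : R => a `^ (p / 2)) _ C D).
have [//|[c [M [cA M0 cE cle]]]] := annulus_sweep r00 rt1 B0 G0 Gc
  (fun t tT => is_derive_continuous (chid t tT)) chiT chit1; exfalso.
have cr : ext_open r0 c by case/andP: cA => + _; exact: lt_trans.
have cc : ext_closed r0 c by exact: ltW.
have c0 : 0 < eucl c by rewrite (lt_trans r00).
set t := ln (eucl c) in cE *.
have tT : t1 < t < T by rewrite -ltr_expR -[X in _ && X]ltr_expR lnK.
have tT' : t1 <= t <= T by case/andP: tT => ? ?; rewrite !ltW.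
have chit : 0 < chi t by rewrite cE mulr_gt0 ?G0.
pose z s := 2 / p * (ln (chi s) - ln M); pose z1 s := 2 / p * (chi1 s / chi s).
pose z2 := 2 / p * (chi2 t / chi t - (chi1 t / chi t) ^+ 2).
have chic := is_derive_continuous (chid t tT').
have near_chi : \forall s \near t, 0 < chi s := chic _ (lt_nbhsr chit).
have near_t : \forall s \near t, t1 <= s <= T.
  case/andP: tT => ? ?.
  by near=> s; apply/andP; split; apply: ltW; near: s; [exact: lt_nbhsr|exact: lt_nbhsl].
have zd : \forall s \near t, is_derive (s : R) 1 z (z1 s).
  apply: filterS2 near_chi near_t => s cs sT; apply: is_derive_scale1.
  have D := is_deriveB (is_derive_comp_ln cs (chid s sT)) (is_derive_cst (ln M) s (1 : R)).
  by apply: (is_derive_eq D); rewrite subr0.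
have z1d : is_derive t 1 z1 z2.
  apply: is_derive_scale1.
  have D := is_derive_mul1 (chi1d t tT)
    (is_derive_comp_inv (lt0r_neq0 chit) (chid t tT')).
  by apply: (is_derive_eq D); field; rewrite gt_eqF.
have expF y : ext_closed r0 y -> F y = expR (2 / p * ln (F y `^ (p / 2))).
  move=> yr; rewrite ln_powR mulrA [2 / p * _](_ : _ = 1) ?mul1r ?lnK //.
    exact: weighted_gt0.
  by field; rewrite gt_eqF.
have zE : expR (z t) = F c.
  by rewrite (expF c cc) /z cE lnM ?posrE ?G0 // addrC addKr.
have zle (y : 'rV[R]_N) : expR t1 <= eucl y <= expR T -> 0 < chi (ln (eucl y)) ->
    expR (z (ln (eucl y))) <= F y.
  move=> yA chiy; have yr : ext_closed r0 y.
    by case/andP: yA => y1 _; rewrite /ext_closed /= (le_trans _ y1) // ltW.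
  rewrite (expF y yr) ler_expR ler_wpM2l ?divr_ge0 ?(ltW p0) //.
  by rewrite lerBlDl -lnM ?posrE ?G0 // ler_ln ?posrE ?mulr_gt0 ?G0 // cle.
have wF (y : 'rV[R]_N) : w y = F y / expR (gam * ln (eucl y)).
  by rewrite /F mulfK // gt_eqF // expR_gt0.
have near_y : \forall y \near c, 0 < chi (ln (eucl y)) :=
  continuous_ln_eucl c0 near_chi.
have zw : expR (z t - gam * t) = w c by rewrite expRB zE wF.
have zwle : \forall y \near c, expR (z (ln (eucl y)) - gam * ln (eucl y)) <= w y.
  apply: filterS2 (near_annulus cA) near_y => y yA chiy.
  by rewrite expRB wF ler_pM2r ?invr_gt0 ?expR_gt0 // zle.
have [_] := log_touching cr zd z1d (chiq t tT chit) zw zwle.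
(* If chi' < 0, some smaller sphere |x| = exp s has exp (z s) > exp (z t). The bound exp (z s) <= F
   there spreads outward by [weighted_min_nondecreasing] and contradicts exp (z t) = F c. *)
have q0 : 0 <= z1 t.
  rewrite leNgt; apply/negP => q0; case/andP: tT => t1t _.
  have chi1t : chi1 t < 0.
    by move: q0; rewrite /z1 pmulr_rlt0 ?divr_gt0 // pmulr_llt0 // invr_gt0.
  have [s /andP[s1 st] cs] := is_derive_lt0_left (chid t tT') chi1t t1t.
  have rs : r0 < expR s by rewrite (lt_trans rt1) // ltr_expR.
  have sT : expR t1 <= expR s <= expR T.
    by rewrite !ler_expR (ltW s1) (le_trans (ltW st)) //; case/andP: tT'.
  have Bs (y : 'rV[R]_N) : eucl y = expR s -> expR (z s) <= F y.
    move=> ys; have := zle y; rewrite ys expRK; apply=> //.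
    exact: lt_trans cs.
  have := weighted_min_nondecreasing rs (expR_gt0 _) Bs.
  move=> /(_ c); rewrite -[eucl c]lnK // -/t ler_expR => /(_ (ltW st)).
  rewrite -zE ler_expR leNgt => /negP; apply.
  by rewrite ltr_pM2l ?divr_gt0 // ltrD2r ltr_ln ?posrE // (lt_trans chit).
move=> /(_ q0).
apply/negP; rewrite -ltNge.
have -> : z2 + p / 2 * z1 t ^+ 2 + epsn / t ^+ 2 =
   2 / p / chi t * (chi2 t + p / 2 * epsn / t ^+ 2 * chi t).
  by rewrite /z2 /z1; field; rewrite !gt_eqF // (lt_trans ltr01) // ext_ln_gt1.
by rewrite mulr_gt0 ?divr_gt0 ?chiL.
Unshelve. all: by end_near. Qed.

(** In the proof [A] and [D] are t^a L^(-sg) and t^(1-a). The bound of [A] by a multiple of F^(p/2)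
    is obtained first for |x| >= exp t1; compactness covers the remaining annulus. *)
Lemma weighted_lower_bound (a sg : R) : 0 < a -> a <= 1 / 2 -> 0 < sg ->
  p / 2 * epsn = a * (1 - a) ->
  exists C, 0 < C /\ forall x, ext_closed r0 x ->
    expR (a * ln (ln (eucl x)) - sg * ln (ln (ln (eucl x)))) `^ (2 / p) <= C * F x.
Proof.
move=> a0 a12 sg0 aE.
have lr1 : 1 < ln r0 by rewrite -[ltLHS](expRK (1 : R)) ltr_ln ?posrE ?expR_gt0.
(* Past 2a / (p gam) the slope (2/p) (a / t) is below gam, as touching requires. *)
pose t1 := Num.max (ln r0) (2 * a / (p * gam)) + 1.
have [t1r t1g] : ln r0 < t1 /\ 2 * a / (p * gam) < t1.
  by rewrite /t1; split; rewrite ltr_pwDr // le_max lexx ?orbT.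
have rt1 : r0 < expR t1 by rewrite -[ltLHS](lnK (_ : r0 \is Num.pos)) ?posrE // ltr_expR.
have [m m0 mF] : exists2 m, 0 < m &
    forall x : 'rV[R]_N, r0 <= eucl x <= expR t1 -> m <= F x.
  (* Should the annulus contain no point, any positive [m] will do. *)
  have [[x0 Ax0]|H] := pselect ([set x : 'rV[R]_N | r0 <= eucl x <= expR t1] !=set0);
    last by exists 1 => // x Ax; exfalso; apply: H; exists x.
  have Fc : {within [set x : 'rV[R]_N | r0 <= eucl x <= expR t1], continuous F}.
    by apply: continuous_subspaceW weighted_continuous => y /andP[].
  have [c] := EVT_min_rV (ex_intro _ x0 Ax0) (@compact_annulus _ _ _ _) Fc.
  rewrite inE => /andP[cr _] cmin; exists (F c); first exact: weighted_gt0.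
  by move=> x Ax; apply: cmin; rewrite inE.
pose U s := a * ln s - sg * ln (ln s); pose A s := expR (U s).
pose U1 (s : R) := a * s^-1 - sg * (s^-1 / ln s).
pose U2 (s : R) := a * (- 1 / s ^+ 2) -
  sg * (- 1 / s ^+ 2 * (ln s)^-1 + s^-1 * (- s^-1 / ln s ^+ 2)).
pose D s := expR ((1 - a) * ln s).
have Ud (s : R) : 1 < s -> is_derive s 1 U (U1 s).
  move=> s1; have s0 : 0 < s by exact: lt_trans s1.
  have D1 := is_derive1_ln s0.
  have D2 := is_derive_comp_ln (ln_gt0 s1) D1.
  exact: (is_deriveB (is_derive_scale1 a D1) (is_derive_scale1 sg D2)).
have Vd (s : R) : 1 < s -> is_derive s 1 (fun s : R => s^-1) (- 1 / s ^+ 2).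
  move=> s1; have s0 : s != 0 by rewrite gt_eqF // (lt_trans _ s1).
  exact: (is_derive_comp_inv (g := id) s0 (is_derive_id s (1 : R))).
have U1d (s : R) : 1 < s -> is_derive s 1 U1 (U2 s).
  move=> s1; have s0 : 0 < s by exact: lt_trans s1.
  have D1 := is_derive1_ln s0.
  have D2 := is_derive_comp_inv (lt0r_neq0 (ln_gt0 s1)) D1.
  have D3 := is_derive_mul1 (Vd s s1) D2.
  exact: (is_deriveB (is_derive_scale1 a (Vd s s1)) (is_derive_scale1 sg D3)).
pose chi dl s := A s - dl * D s.
pose chi1 dl (s : R) := U1 s * A s - dl * ((1 - a) * s^-1 * D s).
pose chi2 dl (s : R) := (U2 s * A s + U1 s * (U1 s * A s)) -
  dl * ((1 - a) * (- 1 / s ^+ 2) * D s + (1 - a) * s^-1 * ((1 - a) * s^-1 * D s)).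
have Ad (s : R) : 1 < s -> is_derive s 1 A (U1 s * A s).
  by move=> s1; exact: is_derive_comp_expR (Ud s s1).
have Dd (s : R) : 1 < s -> is_derive s 1 D ((1 - a) * s^-1 * D s).
  move=> s1; apply: is_derive_comp_expR; apply: is_derive_scale1.
  by apply: is_derive1_ln; exact: lt_trans s1.
have chid dl (s : R) : 1 < s -> is_derive s 1 (chi dl) (chi1 dl s).
  by move=> s1; exact: (is_deriveB (Ad s s1) (is_derive_scale1 dl (Dd s s1))).
have chi1d dl (s : R) : 1 < s -> is_derive s 1 (chi1 dl) (chi2 dl s).
  move=> s1; have D1 := is_derive_mul1 (U1d s s1) (Ad s s1).
  have D2 := is_derive_mul1 (is_derive_scale1 (1 - a) (Vd s s1)) (Dd s s1).
  exact: (is_deriveB D1 (is_derive_scale1 dl D2)).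
have A0 s : 0 < A s := expR_gt0 _; have D0 s : 0 < D s := expR_gt0 _.
(* With this [B] the product B A equals m^(p/2) on the inner sphere, hence is at most F^(p/2)
   there. *)
pose B := m `^ (p / 2) / A t1.
have B0 : 0 < B by rewrite divr_gt0 // powR_gt0.
have t11 : 1 < t1 by exact: lt_trans t1r.
have outer (x : 'rV[R]_N) : expR t1 <= eucl x -> B * A (ln (eucl x)) <= F x `^ (p / 2).
  move=> xt1; have x0 : 0 < eucl x by rewrite (lt_le_trans (expR_gt0 t1)).
  set t := ln (eucl x); apply/ler_addgt0Pr => e e0.
  (* At the given point the correction B dl D equals [e], which is arbitrary. *)
  pose dl := e / (B * D t); have dl0 : 0 < dl by rewrite divr_gt0 // mulr_gt0.
  (* At this [T] one has L^(-sg) <= dl; as a <= 1 - a, [chi] is nonpositive there. *)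
  pose T := Num.max t (expR (expR (- ln dl / sg))).
  have t1t : t1 <= t by rewrite -ler_expR lnK.
  have tT : t <= T by rewrite le_max lexx.
  have T1 : 1 < T by rewrite (lt_le_trans t11) // (le_trans t1t).
  have chiT : chi dl T <= 0.
    rewrite subr_le0 -[dl](lnK (_ : dl \is Num.pos)) ?posrE // -expRD ler_expR.
    have h1 : - ln dl / sg <= ln (ln T).
      rewrite -ler_expR lnK ?posrE ?ln_gt0 // -ler_expR lnK ?posrE ?(lt_trans ltr01) //.
      by rewrite le_max lexx orbT.
    have {}h1 : - ln dl <= ln (ln T) * sg by rewrite -ler_pdivrMr.
    have h2 : 0 <= (1 - 2 * a) * ln T.
      by rewrite mulr_ge0 ?ln_ge0 ?(ltW T1) // subr_ge0; lra.
    rewrite /U; lra.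
  have in1 s : t1 <= s -> 1 < s by exact: lt_le_trans.
  have C1 s : t1 <= s <= T -> is_derive (s : R) 1 (chi dl) (chi1 dl s).
    by case/andP=> /in1 s1 _; exact: chid.
  have C2 s : t1 < s < T -> is_derive (s : R) 1 (chi1 dl) (chi2 dl s).
    by case/andP=> /ltW /in1 s1 _; exact: chi1d.
  have C3 s : t1 < s < T -> 0 < chi dl s -> 2 / p * (chi1 dl s / chi dl s) < gam.
    move=> /andP[t1s _] cs; have s1 := in1 s (ltW t1s).
    have s0 : 0 < s by exact: lt_trans s1.
    (* The logarithmic derivative of [A] is at most a / s and that of [D] is (1 - a) / s >= a / s,
       so subtracting [D] preserves the bound. *)
    have : chi1 dl s <= a * s^-1 * chi dl s.
      rewrite /chi1 /chi mulrBr; apply: lerB.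
        rewrite ler_pM2r // /U1 gerDl oppr_le0 mulr_ge0 ?(ltW sg0) //.
        by rewrite divr_ge0 ?invr_ge0 ?(ltW s0) // ltW ?ln_gt0.
      rewrite mulrCA ler_pM2l // ler_pM2r // ler_pM2r ?invr_gt0 //; lra.
    rewrite -ler_pdivrMr // => h.
    have p20 : 0 < 2 / p by rewrite divr_gt0.
    apply: (@le_lt_trans _ _ (2 / p * (a * s^-1))); first by rewrite ler_pM2l.
    have -> : 2 / p * (a * s^-1) = (2 * a / p) / s by rewrite !mulrA [2 / p * a]mulrAC.
    rewrite ltr_pdivrMr //; apply: (@le_lt_trans _ _ (gam * (2 * a / (p * gam)))).
      rewrite le_eqVlt; apply/orP; left; apply/eqP.
      by field; rewrite (gt_eqF gam_gt0) (gt_eqF p0).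
    by rewrite ltr_pM2l // (lt_trans t1g).
  have C4 s : t1 < s < T -> 0 < chi dl s ->
      0 < chi2 dl s + p / 2 * epsn / s ^+ 2 * chi dl s.
    move=> /andP[t1s _] _; have s1 := in1 s (ltW t1s).
    have s0 : 0 < s by exact: lt_trans s1.
    have L0 := ln_gt0 s1.
    (* The [D] terms cancel because s^(1-a) solves the linear equation; only the logarithmic factor
       of [A] leaves a remainder. *)
    have -> : chi2 dl s + p / 2 * epsn / s ^+ 2 * chi dl s =
       A s / s ^+ 2 * (sg * (1 - 2 * a) / ln s + sg * (sg + 1) / ln s ^+ 2).
      rewrite aE /chi2 /chi /U1 /U2.
      by field; rewrite !gt_eqF.
    rewrite mulr_gt0 ?divr_gt0 ?exprn_gt0 // ltr_wpDl //.
      by rewrite divr_ge0 ?(ltW L0) // mulr_ge0 ?(ltW sg0) // subr_ge0; lra.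
    by rewrite divr_gt0 ?exprn_gt0 // mulr_gt0 // addr_gt0.
  have C5 (y : 'rV[R]_N) : eucl y = expR t1 -> B * chi dl t1 <= F y `^ (p / 2).
    move=> yt1; apply: (@le_trans _ _ (B * A t1)).
      by rewrite ler_pM2l // gerDl oppr_le0 mulr_ge0 ?(ltW dl0) ?(ltW (D0 _)).
    rewrite /B (divfK (lt0r_neq0 (A0 t1))) ge0_ler_powR ?nnegrE ?divr_ge0 ?(ltW p0) ?(ltW m0) //.
      by apply/ltW/weighted_gt0; rewrite /ext_closed /= yt1 ltW.
    by apply: mF; rewrite yt1 lexx ltW.
  have := subsolution_comparison rt1 B0 C1 C2 C3 C4 chiT C5.
  move=> /(_ x); rewrite xt1 -[X in X <= expR T]lnK // ler_expR tT => /(_ isT).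
  rewrite -/t /chi mulrBr lerBlDr; congr (_ <= _ + _).
  by rewrite /dl; field; rewrite !gt_eqF.
(* [K] bounds [A] for ln r0 <= t <= t1: the increasing term is taken at t1, the decreasing one at ln
   r0. *)
pose K := expR (a * ln t1 - sg * ln (ln (ln r0))).
exists (K `^ (2 / p) / m + (B^-1) `^ (2 / p)); split.
  by rewrite addr_gt0 ?divr_gt0 ?powR_gt0 ?expR_gt0 ?invr_gt0.
move=> x xr; have F0 := weighted_gt0 xr.
have x0 : 0 < eucl x by rewrite (lt_le_trans r00).
have pp : 0 <= 2 / p by rewrite divr_ge0 // ltW.
set t := ln (eucl x); rewrite [X in X `^ _](_ : _ = A t) //.
have rt : ln r0 <= t by rewrite ler_ln.
have t10 : 1 < t by exact: lt_le_trans rt.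
rewrite [X in _ <= X]mulrDl; have [xt1|xt1] := leP (expR t1) (eucl x).
  have O := outer x xt1.
  have H : A t `^ (2 / p) <= (B^-1) `^ (2 / p) * F x.
    have -> : F x = (F x `^ (p / 2)) `^ (2 / p).
      rewrite -powRrM [p / 2 * _](_ : _ = 1) ?powRr1 ?(ltW F0) //.
      by field; rewrite gt_eqF.
    rewrite -powRM ?invr_ge0 ?(ltW B0) ?powR_ge0 // ge0_ler_powR ?nnegrE ?(ltW (A0 t)) //.
      by rewrite mulr_ge0 ?invr_ge0 ?(ltW B0) ?powR_ge0.
    by rewrite [leRHS]mulrC ler_pdivlMr // mulrC.
  by apply: (le_trans H); rewrite lerDr mulr_ge0 ?(ltW F0) // divr_ge0 ?powR_ge0 ?(ltW m0).
have mFx : m <= F x by apply: mF; rewrite (ltW xt1) andbT.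
have AK : A t <= K.
  have tt1 : t <= t1 by rewrite -ler_expR lnK // ltW.
  rewrite ler_expR; apply: lerB.
    by rewrite ler_pM2l // ler_ln ?posrE ?(lt_trans ltr01).
  have llr : 0 < ln (ln r0) by exact: ln_gt0.
  rewrite ler_pM2l // ler_ln ?posrE ?ln_gt0 //.
  by rewrite ler_ln ?posrE ?(lt_trans ltr01).
have AK' : A t `^ (2 / p) <= K `^ (2 / p).
  by rewrite ge0_ler_powR ?nnegrE ?(ltW (A0 t)) ?expR_ge0.
apply: (le_trans AK'); apply: (@le_trans _ _ (K `^ (2 / p) / m * F x)).
  by rewrite -mulrA ler_peMr ?powR_ge0 // mulrC ler_pdivlMr ?mul1r.
by rewrite lerDl mulr_ge0 ?powR_ge0 ?(ltW F0).
Qed.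

(** Everything is read off on the i-th axis, where phi' is the i-th partial derivative of w and so
    is differentiable again. There z (s) = ln (phi (exp s)) + gam s is a touching function at every
    point, and [riccati_growth] bounds it. *)
Lemma weighted_upper_bound (phi : R -> R) (i : 'I_N) (a th : R) :
  (forall x, ext_closed r0 x -> w x = phi (eucl x)) ->
  (forall r, r0 <= r -> derivable phi r 1 /\ derive1 phi r < 0) ->
  a <= 1 / 2 -> p / 2 * epsn = a * (1 - a) ->
  (a < 1 / 2 /\ 0 < th) \/ (a = 1 / 2 /\ 1 < th) ->
  exists C T, 0 < C /\ forall x, ext_open r0 x -> T <= ln (eucl x) ->
    F x <= C * expR ((1 - a) * ln (ln (eucl x)) + th * ln (ln (ln (eucl x)))) `^ (2 / p).
Proof.
move=> wphi phid a12 aE ath.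
have [wC2 _] := wsup.
pose f1 := derive1 phi.
have phid1 (r : R) : r0 <= r -> is_derive r 1 phi (f1 r).
  by move=> rr; have [D _] := phid r rr; apply: (DeriveDef D); rewrite /f1 derive1E.
have phi0 r : r0 <= r -> 0 < phi r.
  move=> rr; have r_ge0 : 0 <= r by rewrite (le_trans (ltW r00)).
  by rewrite -[r](eucl_axis i) // -wphi ?w0 // /ext_closed /= eucl_axis.
have near_r r : r0 < r -> \forall s \near r, r0 < s by exact: lt_nbhsr.
have wline (r : R) : r0 < r -> \forall s \near r, phi s = w (0 + s *: ev R i).
  move=> rr; apply: filterS (near_r r rr) => s rs.
  have s0 : 0 <= s by rewrite ltW // (lt_trans r00).
  by rewrite add0r wphi /ext_closed /= eucl_axis // ltW.
have pdE (r : R) : r0 < r -> pd i w (0 + r *: ev R i) = f1 r.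
  move=> rr; have r_ge0 : 0 <= r by rewrite ltW // (lt_trans r00).
  have xr : ext_open r0 (0 + r *: ev R i) by rewrite add0r /ext_open /= eucl_axis.
  have [wd _ _ _] := wC2; have [D _] := wd _ xr i i.
  have D1 := proj1 (is_derive_line w 0 (ev R i) r _) (DeriveDef D erefl).
  have D2 := near_eq_is_derive (wline r rr) (phid1 r (ltW rr)).
  by rewrite /pd -(derive_val (is_derive := D1)) (derive_val (is_derive := D2)).
pose f2 (r : R) := pd i (pd i w) (0 + r *: ev R i).
have f1d (r : R) : r0 < r -> is_derive r 1 f1 (f2 r).
  move=> rr; have r_ge0 : 0 <= r by rewrite ltW // (lt_trans r00).
  have xr : ext_open r0 (0 + r *: ev R i) by rewrite add0r /ext_open /= eucl_axis.
  have [wd _ _ _] := wC2; have [_ D] := wd _ xr i i.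
  have D1 := proj1 (is_derive_line (pd i w) 0 (ev R i) r _) (DeriveDef D erefl).
  by apply: (near_eq_is_derive _ D1); apply: filterS (near_r r rr) => s; exact: pdE.
pose z s := ln (phi (expR s)) + gam * s.
pose z1 (s : R) := f1 (expR s) * expR s / phi (expR s) + gam.
pose z2 (s : R) := (f2 (expR s) * expR s * expR s + f1 (expR s) * expR s) / phi (expR s) +
  f1 (expR s) * expR s * (- (f1 (expR s) * expR s) / phi (expR s) ^+ 2).
have rexp s : ln r0 < s -> r0 < expR s.
  by move=> rs; rewrite -[ltLHS](lnK (_ : r0 \is Num.pos)) ?posrE // ltr_expR.
have phie (s : R) : ln r0 < s ->
    is_derive s 1 (fun s => phi (expR s)) (f1 (expR s) * expR s).
  move=> rs; exact: (is_derive_comp1 (phid1 _ (ltW (rexp s rs))) (is_derive_expR s)).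
have zd (s : R) : ln r0 < s -> is_derive s 1 z (z1 s).
  move=> rs; have ph0 := phi0 _ (ltW (rexp s rs)).
  exact: (is_deriveD (is_derive_comp_ln ph0 (phie s rs)) (is_derive_mull1 gam s)).
have z1d (s : R) : ln r0 < s -> is_derive s 1 z1 (z2 s).
  move=> rs; have ph0 := phi0 _ (ltW (rexp s rs)).
  have D1 := is_derive_comp1 (f1d _ (rexp s rs)) (is_derive_expR s).
  have D2 := is_derive_mul1 (is_derive_mul1 D1 (is_derive_expR s))
    (is_derive_comp_inv (lt0r_neq0 ph0) (phie s rs)).
  have D3 := is_deriveD D2 (is_derive_cst gam s (1 : R)).
  by apply: (is_derive_eq D3); rewrite addr0.
have expz (y : 'rV[R]_N) : ext_open r0 y ->
    expR (z (ln (eucl y)) - gam * ln (eucl y)) = w y.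
  move=> yr; have yc : ext_closed r0 y by exact: ltW.
  have y0 : 0 < eucl y by exact: lt_trans yr.
  by rewrite /z addrK lnK ?posrE // lnK ?posrE // ?phi0 // wphi.
have ric (t : R) : ln r0 < t -> z2 t + z1 t ^+ 2 < 0 /\
    (0 <= z1 t -> z2 t + p / 2 * z1 t ^+ 2 + epsn / t ^+ 2 <= 0).
  move=> rt; pose x := expR t *: ev R i.
  have xt : ln (eucl x) = t by rewrite eucl_axis ?expR_ge0 // expRK.
  have xr : ext_open r0 x by rewrite /ext_open /= eucl_axis ?expR_ge0 // rexp.
  rewrite -xt in rt *; apply: (log_touching xr _ (z1d _ rt) _ (expz x xr)).
  - by apply: filterS (lt_nbhsr rt) => s; exact: zd.
  (* Strict monotonicity enters here: phi' < 0 means z' < gam. *)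
  - rewrite /z1 gtrDr pmulr_llt0 ?invr_gt0 ?phi0 ?(ltW (rexp _ rt)) //.
    by rewrite pmulr_llt0 ?expR_gt0 //; have [] := phid _ (ltW (rexp _ rt)).
  - by apply: filterS (near_ext_open xr) => y yr; rewrite expz.
have ric' (t : R) : ln r0 < t -> 0 <= z1 t ->
    z2 t + p / 2 * z1 t ^+ 2 + 2 / p * (a * (1 - a)) / t ^+ 2 <= 0.
  move=> rt q0; have [_ /(_ q0)] := ric t rt.
  suff -> : 2 / p * (a * (1 - a)) = epsn by [].
  by rewrite -aE; field; rewrite gt_eqF.
have [C [t2 H]] := riccati_growth p0 zd z1d (fun t rt => proj1 (ric t rt)) a12 ric' ath.
exists (expR C `^ (2 / p)), t2; split; first by rewrite powR_gt0 ?expR_gt0.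
move=> x xr xt; have x0 : 0 < eucl x by exact: lt_trans xr.
rewrite -powRM ?expR_ge0 // -expRD.
have -> : F x = expR (p / 2 * z (ln (eucl x))) `^ (2 / p).
  rewrite -expRM [_ * (2 / p)](_ : _ = z (ln (eucl x))); last first.
    by field; rewrite gt_eqF.
  by rewrite /F -(expz x xr) -expRD subrK.
rewrite ge0_ler_powR ?nnegrE ?expR_ge0 ?divr_ge0 ?(ltW p0) // ler_expR.
exact: H.
Qed.

End Supersolution.

(** * Indicial roots and conclusion *)

Lemma powR_expR {R : realType} (x y : R) : 0 < x -> x `^ y = expR (y * ln x).
Proof. by move=> x0; rewrite /powR gt_eqF. Qed.

(** The quadratic is symmetric under b -> 2/p - b, so the reflection of [beta] is again a root. If
    it is [beta] itself then p beta = 1, and completing the square gives p betab = 1 as well. A root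
    b <= 0 would make the left side nonpositive. *)
Lemma indicial_roots {R : realType} (p A eps beta betab : R) :
  0 < p -> 0 < A -> 0 < eps -> beta <= betab ->
  (forall b, A * (2 - b * p) * b = eps <-> b = beta \/ b = betab) ->
  [/\ 0 < beta, p * beta / 2 <= 1 / 2 & betab = 2 / p - beta].
Proof.
move=> p0 A0 e0 bb H.
have Hb : A * (2 - beta * p) * beta = eps by apply/H; left.
have Hbb : A * (2 - betab * p) * betab = eps by apply/H; right.
have pV : p * p^-1 = 1 by rewrite divff // gt_eqF.
have bE : betab = 2 / p - beta.
  have : A * (2 - (2 / p - beta) * p) * (2 / p - beta) = eps.
    by rewrite -Hb; field; rewrite gt_eqF.
  move=> /H[E|->//].
  have pb : p * beta = 1.
    rewrite -[X in p * X](_ : (2 / p - beta + beta) / 2 = _); last by rewrite E; field.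
    by field; rewrite gt_eqF.
  have : A * (1 - betab * p) ^+ 2 = 0.
    have -> : A * (1 - betab * p) ^+ 2 =
      p * (A * (2 - beta * p) * beta - A * (2 - betab * p) * betab) + A * (1 - p * beta) ^+ 2.
      by ring.
    by rewrite Hb Hbb subrr mulr0 pb subrr expr0n /= mulr0 addr0.
  move/eqP; rewrite mulf_eq0 gt_eqF //= expf_eq0 /= subr_eq0 => /eqP pbb.
  have -> : betab = p^-1 by rewrite -[RHS]mul1r pbb mulfK // gt_eqF.
  have -> : beta = p^-1 by rewrite -[RHS]mulr1 -pb mulrA mulVf ?mul1r // gt_eqF.
  by ring.
have pb1 : p * beta <= 1.
  have : p * beta <= p * (2 / p - beta) by rewrite ler_pM2l // -bE.
  by rewrite mulrBr mulrCA pV; lra.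
split => //; last by lra.
rewrite ltNge; apply/negP => b0.
have : A * (2 - beta * p) * beta <= 0.
  rewrite mulr_ge0_le0 // mulr_ge0 ?(ltW A0) //; lra.
by rewrite Hb leNgt e0.
Qed.

Unset Implicit Arguments.
Set Strict Implicit.

Theorem theorem4p5 (R : realType) (N : nat) (p r0 eps beta betab : R) :
  (2 <= N)%N ->
  2 <= p -> p < N%:R ->
  expR 1 < r0 ->
  let CH := `|(p - N%:R) / p| `^ p in
  let Cstar := (p - 1) / (2 * p) * `|(p - N%:R) / p| `^ (p - 2) in
  0 < eps -> eps <= Cstar ->
  beta <= betab ->
  (forall b : R,
     2^-1 * `|(p - N%:R) / p| `^ (p - 2) * (p - 1) * (2 - b * p) * b = eps
     <-> (b = beta \/ b = betab)) ->
  (* (a) *)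
  (forall w : 'rV[R]_N -> R,
     (forall x, ext_closed r0 x -> 0 < w x) ->
     supersol p CH eps r0 w ->
     forall tau : R, tau < 0 ->
     exists C : R, 0 < C /\
       forall x, ext_closed r0 x ->
         eucl x `^ ((p - N%:R) / p) * ln (eucl x) `^ beta
           * ln (ln (eucl x)) `^ tau <= C * w x)
  /\
  (* (b) *)
  (forall (v : 'rV[R]_N -> R) (phi : R -> R),
     (forall x, ext_closed r0 x -> 0 < v x) ->
     (forall x, ext_closed r0 x -> v x = phi (eucl x)) ->
     (forall r, r0 <= r -> derivable phi r 1 /\ derive1 phi r < 0) ->
     supersol p CH eps r0 v ->
     forall tau : R,
     (eps < Cstar /\ 0 < tau) \/ (eps = Cstar /\ 2 / p < tau) ->
     (* limsup_{|x| -> oo} (...)/v(x) > 0, unfolded *)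
     exists delta : R, 0 < delta /\
       forall M : R, exists x, M < eucl x /\ ext_closed r0 x /\
         delta <= eucl x `^ ((p - N%:R) / p) * ln (eucl x) `^ betab
                    * ln (ln (eucl x)) `^ tau / v x).
Proof.
move=> N2 p2 pN r0e CH Cstar eps0 epsC bb roots.
have p0 : 0 < p by rewrite (lt_le_trans _ p2).
have p1 : 0 < p - 1 by rewrite subr_gt0 (lt_le_trans _ p2) // ltr1n.
have r00 : 0 < r0 by rewrite (lt_trans (expR_gt0 1)).
have g0 : 0 < (N%:R - p) / p by exact: gam_gt0.
have gE := gamE p2 pN.
have gN : (p - N%:R) / p = - ((N%:R - p) / p) by rewrite -opprB mulNr.
have gk0 : 0 < ((N%:R - p) / p) `^ (p - 2) by exact: powR_gt0.
pose A := 2^-1 * ((N%:R - p) / p) `^ (p - 2) * (p - 1).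
have A0 : 0 < A by rewrite !mulr_gt0 // invr_gt0.
have rootsA b : A * (2 - b * p) * b = eps <-> b = beta \/ b = betab.
  by rewrite -roots gE.
have [b0 a12 bE] := indicial_roots p0 A0 eps0 bb rootsA.
have rootb : A * (2 - beta * p) * beta = eps by apply/rootsA; left.
(* A / p is the maximum of A (2 - b p) b, attained at b = 1/p. *)
have CE : Cstar = A / p.
  by rewrite /Cstar gE /A; field; rewrite gt_eqF.
pose a := p * beta / 2.
have aE : p / 2 * (eps / ((p - 1) * ((N%:R - p) / p) `^ (p - 2))) = a * (1 - a).
  rewrite -rootb /A /a; field.
  by rewrite (gt_eqF gk0) (gt_eqF p1).
have ext_ln (x : 'rV[R]_N) : ext_closed r0 x -> 0 < eucl x /\ 1 < ln (eucl x).
  move=> xr; have x0 : 0 < eucl x by exact: lt_le_trans xr.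
  split=> //; rewrite -[ltLHS](expRK (1 : R)) ltr_ln ?posrE ?expR_gt0 //.
  exact: lt_le_trans xr.
(* Puts the comparison function in the form used by the two bounds: exp (- gam t) times a 2/p-th
   power. *)
have profile (b c : R) (x : 'rV[R]_N) : ext_closed r0 x ->
    eucl x `^ ((p - N%:R) / p) * ln (eucl x) `^ b * ln (ln (eucl x)) `^ c =
    expR (- ((N%:R - p) / p * ln (eucl x))) *
    expR (p * b / 2 * ln (ln (eucl x)) + p * c / 2 * ln (ln (ln (eucl x)))) `^ (2 / p).
  move=> xr; have [x0 x1] := ext_ln x xr.
  rewrite (powR_expR _ x0) (powR_expR _ (lt_trans ltr01 x1)) (powR_expR _ (ln_gt0 x1)).
  rewrite -expRM -!expRD gN; congr expR.
  by field; rewrite gt_eqF.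
split.
  move=> w w0 wsup tau tau0.
  have sg0 : 0 < - (p * tau / 2) by rewrite oppr_gt0 pmulr_llt0 ?invr_gt0 // pmulr_rlt0.
  have a0 : 0 < a by rewrite divr_gt0 // mulr_gt0.
  have [C [C0 H]] := weighted_lower_bound p2 pN r0e eps0 w0 wsup a0 a12 sg0 aE.
  exists C; split=> // x xr; rewrite profile //.
  have := H x xr; rewrite mulNr opprK -/a => Hx.
  rewrite expRN mulrC ler_pdivrMr ?expR_gt0 // -[leRHS]mulrA; exact: Hx.
move=> v phi v0 vphi phid vsup tau ht.
have i : 'I_N by apply: (Ordinal (_ : 0 < N)%N); exact: leq_trans N2.
have ath : (a < 1 / 2 /\ 0 < p * tau / 2) \/ (a = 1 / 2 /\ 1 < p * tau / 2).
  (* By completing the square, eps < Cstar exactly when p beta differs from 1, that is when a <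
     1/2. *)
  have sq : eps = Cstar - A / p * (1 - p * beta) ^+ 2.
    by rewrite CE -rootb; field; rewrite gt_eqF.
  case: ht => -[he ht]; [left|right]; split.
  - rewrite lt_neqAle a12 andbT; apply/eqP => E.
    have pb : p * beta = 1 by move: E; rewrite /a; lra.
    by move: he; rewrite sq pb subrr expr0n /= mulr0 subr0 ltxx.
  - by rewrite divr_gt0 // mulr_gt0.
  - have /eqP : A / p * (1 - p * beta) ^+ 2 = 0 by move: sq; rewrite -he; lra.
    rewrite mulf_eq0 gt_eqF ?divr_gt0 //= expf_eq0 /= subr_eq0 => /eqP E.
    by rewrite /a -E.
  - by rewrite ltr_pdivlMr // mul1r mulrC -ltr_pdivrMr.
have [C [T [C0 H]]] := weighted_upper_bound p2 pN r0e eps0 v0 vsup i vphi phid a12 aE ath.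
exists C^-1; split; first by rewrite invr_gt0.
(* A point on one axis suffices, with radius beyond M, r0 and the threshold exp T of the upper
   bound. *)
move=> M; pose r := Num.max (Num.max M r0) (expR T) + 1.
have [rM rr rT] : [/\ M < r, r0 < r & expR T < r].
  by rewrite /r; split; rewrite ltr_pwDr // !le_max lexx ?orbT.
have r_ge0 : 0 <= r by rewrite ltW // (lt_trans r00).
pose x := r *: ev R i; have xE : eucl x = r by exact: eucl_axis.
have xr : ext_closed r0 x by rewrite /ext_closed /= xE ltW.
exists x; split; first by rewrite xE.
split=> //; rewrite profile // ler_pdivlMr ?v0 //.
have := H x; rewrite /ext_open /= xE rr => /(_ isT).
have -> : T <= ln r by rewrite -ler_expR lnK ?posrE ?(lt_trans r00) // ltW.
move=> /(_ isT).
have -> : p * betab / 2 = 1 - a by rewrite bE /a; field; rewrite gt_eqF.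
move=> Hx; rewrite expRN ler_pdivrMl // mulrCA mulrC.
by rewrite ler_pdivlMr ?expR_gt0.
Qed.
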